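(* Let $L>0$ and let $\mu$ be a probability measure on $\mathbb{R}^n$, absolutely continuous with respect to Lebesgue measure, such that for every $p\ge2$ and every smooth function $f\colon\mathbb{R}^n\to\mathbb{R}$, $$\|f-\mathbb{E}_\mu f\|_p\le L\sqrt p\,\big\||\nabla f|_2\big\|_p .$$ Let $f\colon\mathbb{R}^n\to\mathbb{R}$ be a function of class $\mathcal{C}^2$ such that the operator norm of $\mathbf{D}^2f$ is uniformly bounded on $\mathbb{R}^n$. Then for every $t>0$, $$\mu\big(|f-\mathbb{E}_\mu f|\ge t\big)\le e^2\exp\Big(-\min\Big(\frac{t^2}{a^2},\frac tb\Big)\Big),$$ where $$a^2=4e^2\Big(\sqrt2L^2\big\||\mathbf{D}^2f|_{\mathrm{HS}}\big\|_2+L\,|\mathbb{E}_\mu\nabla f|_2\Big)^2,\qquad b=2eL^2\big\||\mathbf{D}^2f|_{\mathrm{op}}\big\|_\infty .$$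
   Context: $\mathbb{E}_\mu$ is integration with respect to $\mu$ (applied coordinatewise to vectors); $\|g\|_p=(\mathbb{E}_\mu|g|^p)^{1/p}$ for $p<\infty$ and $\|g\|_\infty$ is the $L^\infty(\mu)$ norm; $|\cdot|_2$ is the Euclidean norm. $\mathbf{D}^2f$ is the Hessian matrix; for a matrix $A=(a_{ij})$, $|A|_{\mathrm{HS}}=(\sum_{i,j}a_{ij}^2)^{1/2}$ and $|A|_{\mathrm{op}}=\sup_{|x|_2,|y|_2\le1}\sum_{i,j}a_{ij}x_iy_j$. Ratios with denominator $0$ (if $a=0$ or $b=0$) are read as $+\infty$. The moment inequality in the hypothesis is regarded as trivially satisfied when its right-hand side is infinite. *)

(* Defs.v *)
From HB Require Import structures.
From mathcomp Require Import all_boot all_order all_algebra.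
From mathcomp Require Import all_classical all_reals all_analysis.

Set Implicit Arguments.
Unset Strict Implicit.
Unset Printing Implicit Defensive.

Import Order.TTheory GRing.Theory Num.Theory.
Import numFieldNormedType.Exports.

Local Open Scope classical_set_scope.
Local Open Scope ring_scope.

(* 'rV[R]_n carries its Borel sigma-algebra. *)
HB.instance Definition _ (R : realType) (n : nat) :=
  Measurable.copy 'rV[R]_n (g_sigma_algebraType (@open 'rV[R]_n)).

(* Lebesgue measure of a Borel set of R^n, by iterated integration of its
   sections: the measure of R^n.+1 is the product of the one-dimensional Lebesgue
   measure and of that of R^n (compare with `\x` on product types). R^0 is a
   point of mass 1. *)
Fixpoint lebesgue_rV (R : realType) (n : nat) : set 'rV[R]_n -> \bar R :=
  match n with
  | 0%N => fun A => \d_(0 : 'rV[R]_0) A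
  | n'.+1 => fun A =>
      (\int[@lebesgue_measure R]_x
        lebesgue_rV [set v : 'rV[R]_n' | A (row_mx (x%:M : 'rV[R]_1) v)])%E
  end.

Section calculus.
Context {R : realType} {n : nat}.
Implicit Types (f : 'rV[R]_n -> R) (x : 'rV[R]_n) (A : 'M[R]_n).

(* The norm `|x| of the library on row vectors is the sup norm. *)
Definition enorm x : R := Num.sqrt (\sum_i x ord0 i ^+ 2).

Definition partial (i : 'I_n) f : 'rV[R]_n -> R := 'D_(delta_mx ord0 i) f.

(* All iterated partial derivatives of order <= k exist and are continuous. *)
Fixpoint Ck (k : nat) f : Prop :=
  match k with
  | 0%N => continuous f
  | k'.+1 => continuous f /\
      forall i, (forall x, derivable f x (delta_mx ord0 i)) /\
                Ck k' (partial i f)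
  end.

Definition smooth f : Prop := forall k, Ck k f.

Definition grad f x : 'rV[R]_n := \row_i partial i f x.

Definition hessian f x : 'M[R]_n := \matrix_(i, j) partial i (partial j f) x.

Definition hsnorm A : R := Num.sqrt (\sum_i \sum_j A i j ^+ 2).

Definition opnorm A : R :=
  sup [set r | exists x y, [/\ enorm x <= 1, enorm y <= 1 &
                 r = \sum_i \sum_j A i j * x ord0 i * y ord0 j]].

End calculus.

Section expectation.
Context {R : realType} {n : nat} (mu : probability 'rV[R]_n R).

(* `Rintegral` takes the value 0 on functions without a finite integral. *)
Definition mean (f : 'rV[R]_n -> R) : R := \int[mu]_x f x.

Definition vmean (F : 'rV[R]_n -> 'rV[R]_n) : 'rV[R]_n :=
  \row_i mean (fun x => F x ord0 i).

End expectation.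

(* Main.v *)
(* For p >= 2 the hypothesis, once extended to functions of class C^1 with
   polynomially growing gradient by mollification, is applied to f, to the
   regularized norm g_e = (e^2 + |grad f - v|^2)^(1/2) with v = E grad f, and, for
   p = 2, to the components of grad f. Since |grad g_e| <= |D^2 f|_op and
   E g_e <= (e^2 + sum_i Var(d_i f))^(1/2) <= e + 2^(1/2) L || |D^2 f|_HS ||_2,
   letting e tend to 0 gives
     || f - E f ||_p <= (p^(1/2) a + p b) / (2 exp 1),
   and Markov's inequality with p = min (t^2 / a^2, t / b) concludes. Regularizing
   the norm avoids differentiating a Lipschitz function almost everywhere. The
   hypothesis itself provides all moments of |x|, through the coordinate functions. *)
Require Import Defs.
From HB Require Import structures.
From mathcomp Require Import all_boot all_order all_algebra.
From mathcomp Require Import all_classical all_reals all_analysis.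
From mathcomp Require Import measurable_realfun ess_sup_inf.
From mathcomp Require Import ring lra.

Set Implicit Arguments.
Unset Strict Implicit.
Unset Printing Implicit Defensive.

Import Order.TTheory GRing.Theory Num.Theory.
Import numFieldNormedType.Exports.

Local Open Scope classical_set_scope.
Local Open Scope ring_scope.

(** * Kernels and integrals over [0, 1] *)

(** The inequality is used at exponent p for [f] and again for the regularized norm, and each use
    costs a factor [L * sqrt p]. The product of the two factors is the term linear in p, hence the
    regime [t / b]; the constants |v| and E g_e meet only one factor and give the Gaussian regime.
    Subtracting v before taking norms turns the bound on E g_e into a sum of variances, which the
    case p = 2 controls. The factors 2 exp 1 in a and b bring the p-norm down to t / exp 1, so that
    Markov's inequality yields exp (- p); the prefactor exp 2 pays for minima below 2, where no
    exponent p is admissible. Two obstacles shape the rest. For f of class C^2 the function g_e is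
    only of class C^1, whereas the hypothesis speaks of smooth functions; mollification is done one
    coordinate at a time, with kernels built from exp (- 1 / s), so that its integrals are all over
    [0, 1]. Integrability of f and its derivatives has to be derived: a bounded Hessian gives
    polynomial growth, and polynomial weights are integrable and dominate the limits of
    mollifications. *)

Section pointwise_continuity.
Context {R : realType} {T : topologicalType}.
Implicit Types f g : T -> R.

Lemma continuous_addf f g : continuous f -> continuous g ->
  continuous (fun x => f x + g x).
Proof. by move=> cf cg x; exact: (@cvgD _ _ _ (nbhs x) _ f g _ _ (cf x) (cg x)). Qed.

Lemma continuous_subf f g : continuous f -> continuous g ->
  continuous (fun x => f x - g x).
Proof. by move=> cf cg x; exact: (@cvgB _ _ _ (nbhs x) _ f g _ _ (cf x) (cg x)). Qed.

Lemma continuous_mulf f g : continuous f -> continuous g ->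
  continuous (fun x => f x * g x).
Proof. by move=> cf cg x; exact: (@cvgM _ _ (nbhs x) _ f g _ _ (cf x) (cg x)). Qed.

Lemma continuous_expf f (k : nat) : continuous f -> continuous (fun x => f x ^+ k).
Proof.
move=> cf; elim: k => [|k IHk]; first exact: cst_continuous.
rewrite (_ : (fun x => _) = (fun x => f x * f x ^+ k)); last first.
  by apply/funext => x; rewrite exprS.
exact: continuous_mulf.
Qed.

Lemma continuous_sumf (I : Type) (s : seq I) (f : I -> T -> R) :
  (forall i, continuous (f i)) -> continuous (fun x => \sum_(i <- s) f i x).
Proof.
move=> cf x.
by apply: (cvg_big (@add_continuous R)) => i _; exact: cf.
Qed.

Lemma continuous_normf f : continuous f -> continuous (fun x => `|f x|).
Proof. by move=> cf x; exact: (@cvg_norm _ _ _ (nbhs x) _ f _ (cf x)). Qed.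

Lemma continuous_sqrtf f : continuous f -> continuous (fun x => Num.sqrt (f x)).
Proof.
by move=> cf x; apply: continuous_comp; [exact: cf|exact: sqrt_continuous].
Qed.

End pointwise_continuity.

Section flat_functions.
Context {R : realType}.
Implicit Types (m k : nat) (s : R) (phi : R -> R).

(* All derivatives of flat m vanish at 0. *)
Definition flat m s : R := if 0 < s then s^-1 ^+ m * expR (- s^-1) else 0.

Lemma flat_le0 m s : s <= 0 -> flat m s = 0.
Proof. by rewrite /flat leNgt => /negbTE ->. Qed.

Lemma flat_ge0 m s : 0 <= flat m s.
Proof.
rewrite /flat; case: ifP => // s0.
by rewrite mulr_ge0 ?expR_ge0// exprn_ge0// invr_ge0 ltW.
Qed.

(** Differentiation on the positive half-line stays within linear combinations of the family, which
    is why the power of [s^-1] is a parameter. *)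
Lemma is_derive_flat m s : 0 < s ->
  is_derive s 1 (flat m) (flat m.+2 s - m%:R * flat m.+1 s).
Proof.
move=> s0.
have dV : is_derive s 1 (fun y : R => y^-1) (- s^-1 ^+ 2).
  have := @is_deriveV R id s 1 1 (lt0r_neq0 s0) (is_derive_id _ _).
  by rewrite scaler1 exprVn.
have dX : is_derive s 1 (fun y : R => y^-1 ^+ m)
    ((m%:R * s^-1 ^+ m.-1) * (- s^-1 ^+ 2)) 
  by have := is_deriveX m dV; rewrite exprfctE.
have dE : is_derive s 1 (fun y : R => expR (- y^-1))
    (expR (- s^-1) * s^-1 ^+ 2).
  apply: (@is_derive1_comp _ expR (fun y : R => - y^-1)).
  by have := is_deriveN dV; rewrite opprK.
have dM := is_deriveM dX dE.
pose g : R -> R := (fun y : R => y^-1 ^+ m) * (fun y : R => expR (- y^-1)).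
apply: (@near_eq_is_derive _ _ _ g).
  near=> y; rewrite /flat ifT//.
  by near: y; exact: lt_nbhsr.
apply: is_derive_eq dM _.
(* The power rule leaves the truncated exponent [m.-1], so m = 0 is treated apart. *)
rewrite /flat s0 /GRing.scale/=; case: m {dX g} => [|m] /=; rewrite ?expr0.
  by rewrite !mul0r mulr0 !mul1r addr0 subr0 mulrC.
by rewrite !exprS; ring.
Unshelve. all: by end_near. Qed.

(** One term of the exponential series, exp x >= x^(m+1) / (m+1)! at x = 1 / s, beats the power of
    [s^-1] with one factor [s] to spare. This linear bound gives continuity at 0 by squeezing. *)
Lemma flat_le m s : 0 <= s -> flat m s <= (m.+1)`!%:R * s.
Proof.
rewrite le_eqVlt => /predU1P[<-|s0]; first by rewrite flat_le0// mulr0.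
rewrite /flat s0 expRN ler_pdivrMr ?expR_gt0//.
have sV0 : 0 <= s^-1 by rewrite invr_ge0 ltW.
have /(ler_wpM2l (ltW s0)) := expR_ge1Dxn m sV0.
have f0 : (0 : R) < (m.+1)`!%:R by rewrite ltr0n fact_gt0.
move=> /(ler_wpM2l (ltW f0)); rewrite [leRHS]mulrA; apply: le_trans.
have -> : (m.+1)`!%:R * (s * (1 + s^-1 ^+ m.+1 / (m.+1)`!%:R)) =
    (m.+1)`!%:R * s + s^-1 ^+ m.
  rewrite exprS; field; rewrite (lt0r_neq0 s0)/=.
  by rewrite (lt0r_neq0 f0).
by rewrite lerDr mulr_ge0// ltW.
Qed.

Lemma continuous_flat m : continuous (flat m).
Proof.
move=> s; have [s0|s0|->] := ltgtP s 0.
- have : {near s, cst 0 =1 flat m}.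
    near=> y; rewrite flat_le0//; apply/ltW.
    by near: y; exact: lt_nbhsl.
  by move/near_eq_cvg/cvg_trans; apply; rewrite flat_le0 ?ltW//; exact: cvg_cst.
- have [/derivable1_diffP/differentiable_continuous] := is_derive_flat m s0.
  by [].
- rewrite /continuous_at flat_le0//.
  apply: (@squeeze_cvgr _ _ _ _ (cst 0) (fun y => (m.+1)`!%:R * `|y|)).
  + apply: nearW => y; rewrite flat_ge0/=.
    have [y0|y0] := leP 0 y; first by rewrite ger0_norm// flat_le.
    by rewrite flat_le0 ?(ltW y0)// mulr_ge0.
  + exact: cvg_cst.
  + rewrite -[X in _ --> X](mulr0 (m.+1)`!%:R); apply: cvgM; first exact: cvg_cst.
    by rewrite -[X in _ --> X](@normr0 _ R); apply: cvg_norm; exact: cvg_id.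
Unshelve. all: by end_near. Qed.

(* A class of kernels closed under differentiation, all of whose members vanish
   at both ends of [0, 1]; only its values on [0, 1] matter. *)
Inductive kern : (R -> R) -> Prop :=
| kern_flat m k : kern (fun s => flat m s * flat k (1 - s))
| kernD phi1 phi2 : kern phi1 -> kern phi2 -> kern (fun s => phi1 s + phi2 s)
| kernZ c phi : kern phi -> kern (fun s => c * phi s).

Lemma kern_continuous phi : kern phi -> continuous phi.
Proof.
elim=> [m k|phi1 phi2 _ c1 _ c2|c {}phi _ c1] s.
- apply: cvgM; first exact: continuous_flat.
  apply: (@continuous_comp _ _ _ (fun s => 1 - s) (flat k)).
    by apply: cvgB; [exact: cvg_cst|exact: cvg_id].
  exact: continuous_flat.
- by apply: cvgD; [exact: c1|exact: c2].
- by apply: cvgM; [exact: cvg_cst|exact: c1].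
Qed.

Lemma kern0 phi : kern phi -> phi 0 = 0.
Proof.
elim=> [m k|phi1 phi2 _ c1 _ c2|c {}phi _ c1].
- by rewrite flat_le0// mul0r.
- by rewrite c1 c2 addr0.
- by rewrite c1 mulr0.
Qed.

Lemma kern1 phi : kern phi -> phi 1 = 0.
Proof.
elim=> [m k|phi1 phi2 _ c1 _ c2|c {}phi _ c1].
- by rewrite subrr (flat_le0 _ (lexx _)) mulr0.
- by rewrite c1 c2 addr0.
- by rewrite c1 mulr0.
Qed.

(** The product rule on the generators, with a sign from the inner function 1 - s. Derivatives on
    the open interval suffice: integration by parts asks only for continuity at the endpoints. *)
Lemma kern_derive phi : kern phi -> exists2 dphi, kern dphi &
  forall s, 0 < s < 1 -> is_derive s 1 phi (dphi s).
Proof.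
elim=> [m k|phi1 phi2 _ [d1 kd1 dp1] _ [d2 kd2 dp2]|c {}phi _ [d1 kd1 dp1]].
- exists (fun s => (flat m.+2 s * flat k (1 - s) +
      (- m%:R) * (flat m.+1 s * flat k (1 - s))) +
      ((-1) * (flat m s * flat k.+2 (1 - s)) +
       k%:R * (flat m s * flat k.+1 (1 - s)))).
    by repeat (apply: kern_flat || apply: kernD || apply: kernZ).
  move=> s /andP[s0 s1].
  have d1 := is_derive_flat m s0.
  have s10 : 0 < 1 - s by rewrite subr_gt0.
  have d2 := is_derive_flat k s10.
  have dB : is_derive s 1 (fun s : R => 1 - s) (-1).
    have := is_deriveB (is_derive_cst (1 : R) s (1 : R)) (is_derive_id s (1 : R)).
    by rewrite sub0r.
  have dM := is_deriveM d1
    (@is_derive1_comp _ (flat k) (fun s : R => 1 - s) _ _ _ d2 dB).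
  by apply: is_derive_eq dM _; rewrite /= /GRing.scale/=; ring.
- exists (fun s => d1 s + d2 s); first exact: kernD.
  by move=> s s01; apply: is_deriveD; [exact: dp1|exact: dp2].
- exists (fun s => c * d1 s); first exact: kernZ.
  by move=> s s01; apply: is_deriveZ; exact: dp1.
Qed.

End flat_functions.

Section integral01.
Context {R : realType}.
Implicit Types (f g phi : R -> R).

Definition int01 f : R := \int[@lebesgue_measure R]_(s in `[0, 1]) f s.

Lemma integrable01 f : continuous f ->
  (@lebesgue_measure R).-integrable `[0, 1] (EFin \o f).
Proof.
move=> cf; apply: continuous_compact_integrable; first exact: segment_compact.
exact: continuous_subspaceT.
Qed.

Lemma eq_int01 f g : (forall s, 0 <= s <= 1 -> f s = g s) -> int01 f = int01 g.
Proof.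
move=> fg; apply: eq_Rintegral => s; rewrite inE/= in_itv/=; exact: fg.
Qed.

Lemma int01_cst c : int01 (fun=> c) = c.
Proof.
rewrite /int01 Rintegral_cst//= lebesgue_measure_itv/= lte_fin ltr01.
by rewrite -EFinB/= subr0 mulr1.
Qed.

Lemma ler_int01 f g : continuous f -> continuous g ->
  (forall s, 0 <= s <= 1 -> f s <= g s) -> int01 f <= int01 g.
Proof.
move=> cf cg fg; apply: le_Rintegral => //.
- exact: integrable01.
- exact: integrable01.

Qed.

Lemma int01B f g : continuous f -> continuous g ->
  int01 (fun s => f s - g s) = int01 f - int01 g.
Proof. by move=> cf cg; apply: RintegralB => //; exact: integrable01. Qed.

Lemma int01Zl c f : continuous f -> int01 (fun s => c * f s) = c * int01 f.
Proof. by move=> cf; apply: RintegralZl => //; exact: integrable01. Qed.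

Lemma normr_int01_le f c : continuous f ->
  (forall s, 0 <= s <= 1 -> `|f s| <= c) -> `|int01 f| <= c.
Proof.
move=> cf fc.
have cst_c k : continuous (fun _ : R => k : R) by move=> ?; exact: cvg_cst.
rewrite ler_norml -[X in _ && (_ <= X)](int01_cst c) -[X in X <= _](int01_cst (- c)).
by apply/andP; split; apply: ler_int01 => // s /fc; rewrite ler_norml => /andP[].
Qed.

(** A tube-lemma argument: near each (x0, s) both values are within d / 2 of [h x0 s], and
    compactness of [0, 1] yields one neighbourhood of x0 valid for all s. *)
Lemma near_unif01 (X : topologicalType) (h : X -> R -> R) (x0 : X) (d : R) :
  continuous (fun p : X * R => h p.1 p.2) -> 0 < d ->
  \forall x \near x0, forall s, 0 <= s <= 1 -> `|h x s - h x0 s| <= d.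
Proof.
move=> ch d0.
have /compact_near_coveringP cK := @segment_compact R 0 1.
have d20 : 0 < d / 2 by rewrite divr_gt0.
have cov : forall s : R, `[0, 1]%classic s ->
    \forall s' \near s & x \near x0, `|h x s' - h x0 s'| <= d.
  move=> s _.
  have /cvgrPdist_lt/(_ _ d20) := ch (x0, s).
  case=> -[U V] /= [Ux Vs] UV; exists (V, U) => //= -[s' x] /= [Vs' Ux'].
  have h1 := UV (x, s') (conj Ux' Vs').
  have h2 := UV (x0, s') (conj (nbhs_singleton Ux) Vs').
  rewrite /= in h1 h2.
  have -> : h x s' - h x0 s' = (h x0 s - h x0 s') - (h x0 s - h x s') by ring.
  rewrite (le_trans (ler_normB _ _))// [leRHS]splitr lerD// ltW//.
have H := cK X (nbhs x0) (fun x s => `|h x s - h x0 s| <= d)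
  (nbhs_filter x0) cov.
apply: (@filterS _ _ (nbhs_filter x0) _ _ _ H) => x Kx s s01; apply: Kx.
by rewrite /= in_itv/=.
Qed.

Lemma continuous_section (X : topologicalType) (h : X -> R -> R) (x0 : X) :
  continuous (fun p : X * R => h p.1 p.2) ->
  continuous (h x0).
Proof.
move=> ch s.
by apply: (@continuous2_cvg _ X R R (nbhs s) _ (fun=> x0) id h x0 s
  (ch (x0, s))); [exact: cvg_cst|exact: cvg_id].
Qed.

Lemma continuous_int01 (X : topologicalType) (h : X -> R -> R) :
  continuous (fun p : X * R => h p.1 p.2) ->
  continuous (fun x => int01 (h x)).
Proof.
move=> ch x0; apply/cvgrPdist_le => d d0.
have := near_unif01 x0 ch d0; apply: filterS => x hx.
rewrite -int01B; [|exact: continuous_section..].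
apply: normr_int01_le => [s|s s01].
  by apply: continuousB; exact: continuous_section.
by rewrite distrC hx.
Qed.

Lemma is_derive_int01 (h dh : R -> R -> R) (r0 : R) :
  continuous (fun p : R * R => h p.1 p.2) ->
  continuous (fun p : R * R => dh p.1 p.2) ->
  (forall r s : R, is_derive r 1 (fun r => h r s) (dh r s)) ->
  is_derive r0 1 (fun r => int01 (h r)) (int01 (dh r0)).
Proof.
move=> ch cdh dhE.
(* On this interval around r0 the derivative stays within 1 of [dh r0], which makes [1 + |dh r0 s|]
   an integrable majorant independent of r. *)
have [e /= e0 He] := near_unif01 r0 cdh ltr01.
have r0I : `](r0 - e), (r0 + e)[%classic r0.
  by rewrite /= in_itv/= ltrDl e0 ltrBlDr ltrDl e0.
have cG : continuous (fun s => 1 + `|dh r0 s|).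
  move=> s; apply: cvgD; first exact: cvg_cst.
  by apply: cvg_norm; exact: continuous_section.
have derE r s : partial1of2 h r s = dh r s.
  by rewrite partial1of2E; have [_ ->] := dhE r s.
have m01 : measurable (`[0, 1]%classic : set R) by [].
have ih x : `](r0 - e), (r0 + e)[%classic x ->
    (@lebesgue_measure R).-integrable `[0, 1] (EFin \o h x).
  by move=> _; apply: integrable01; exact: continuous_section.
have dh' x y : `](r0 - e), (r0 + e)[%classic x -> `[0, 1]%classic y ->
   derivable (h ^~ y) x 1 by move=> _ _; have [] := dhE x y.
have G0 y : 0 <= 1 + `|dh r0 y| by rewrite addr_ge0.
have Gub x y : `](r0 - e), (r0 + e)[%classic x -> `[0, 1]%classic y ->
    `|partial1of2 h x y| <= 1 + `|dh r0 y|.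
  rewrite /= !in_itv/= derE => /andP[x1 x2] y01.
  have H : `|dh x y - dh r0 y| <= 1.
    by apply: He => //=; rewrite ltr_distlC x1 x2.
  have -> : dh x y = (dh x y - dh r0 y) + dh r0 y by ring.
  by rewrite (le_trans (ler_normD _ _))// lerD.
have h2 := @derivable_under_integral R _ _ (@lebesgue_measure R) h _ m01 _ _ _
  r0I ih dh' _ G0 (integrable01 cG) Gub.
have h1 := @differentiation_under_integral R _ _ (@lebesgue_measure R) h _ m01 _ _ _
  r0I ih dh' _ G0 (integrable01 cG) Gub.
split; first exact: h2.
rewrite derive1E in h1; rewrite h1; apply: eq_Rintegral => s _.
exact: derE.
Qed.

End integral01.

Lemma exists_unit_kern (R : realType) : exists2 phi : R -> R, kern phi &
  (forall s, 0 <= phi s) /\ int01 phi = 1.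
Proof.
pose phi0 (s : R) := flat 0 s * flat 0 (1 - s).
have k0 : kern phi0 by exact: kern_flat.
have phi0_ge0 s : 0 <= phi0 s by rewrite mulr_ge0// flat_ge0.
have c0 := kern_continuous k0.
suff J0 : 0 < int01 phi0.
  exists (fun s => (int01 phi0)^-1 * phi0 s); first exact: kernZ.
  split=> [s|]; first by rewrite mulr_ge0// invr_ge0 ltW.
  by rewrite int01Zl// mulVf// gt_eqF.
have i01 := integrable01 c0.
have sub : `[(4^-1 : R), 3 / 4]%classic `<=` `[0, 1]%classic.
  by move=> s; rewrite /= !in_itv/= => /andP[s1 s2]; apply/andP; split; lra.
(* Positivity of the mass: on [1/4, 3/4] both 1 / s and 1 / (1 - s) are at most 4, so the kernel is
   at least exp (- 8) there. *)
apply: (@lt_le_trans _ _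
  (\int[@lebesgue_measure R]_(s in `[4^-1, 3 / 4]) expR (- 8))).
  rewrite Rintegral_cst//= lebesgue_measure_itv/= lte_fin ifT; last lra.
  by rewrite -EFinB/= mulr_gt0 ?expR_gt0//; lra.
have iE : (@lebesgue_measure R).-integrable `[4^-1, 3 / 4] (EFin \o phi0).
  exact: integrableS i01.
apply: (@le_trans _ _ (\int[@lebesgue_measure R]_(s in `[4^-1, 3 / 4]) phi0 s)).
  apply: le_Rintegral => //.
    apply: continuous_compact_integrable; first exact: segment_compact.
    by apply: continuous_subspaceT => x; exact: cvg_cst.
  move=> s; rewrite /= in_itv/= => /andP[s1 s2].
  have s0 : 0 < s by lra.
  have s0' : 0 < 1 - s by lra.
  rewrite /phi0 /flat s0 s0' !expr0 !mul1r -expRD ler_expR.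
  have -> : - s^-1 - (1 - s)^-1 = - (s^-1 + (1 - s)^-1) by rewrite opprD.
  rewrite lerN2.
  have -> : 8 = (4^-1)^-1 + (4^-1)^-1 :> R by rewrite invrK; ring.
  by apply: lerD; rewrite lef_pV2 ?posrE//; lra.
rewrite fine_le//.
- by apply: integrable_fin_num => //.
- by apply: integrable_fin_num => //.
- apply: ge0_subset_integral => //; first exact: (measurable_int _ i01).
  by move=> s _; rewrite lee_fin.
Qed.

(** * Mollification along coordinate directions *)

Section line.
Context {R : realType} {n : nat}.
Implicit Types (f h : 'rV[R]_n -> R) (x v : 'rV[R]_n).

(** The two difference quotients coincide. This is the bridge through which the one-variable
    theorems (chain rule, mean value, integration by parts) reach partial derivatives. *)
Lemma is_derive_line f x v (r d : R) :
  is_derive (r *: v + x) v f d <->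
  is_derive r (1 : R) (fun t : R => f (t *: v + x)) d.
Proof.
have E : (fun t : R => t^-1 *: ((f \o shift (r *: v + x)) (t *: v) -
      f (r *: v + x))) =
    (fun t : R => t^-1 *: (((fun t : R => f (t *: v + x)) \o shift r) (t *: (1 : R)) -
      f (r *: v + x))).
  apply/funext => t /=; rewrite /GRing.scale/= mulr1.
  by rewrite -[(t + r) *: v + x]/((t + r) *: v + x) scalerDl addrA.
by split=> -[h1 h2]; split; rewrite /derivable /derive ?E// in h1 h2 *; rewrite -?E.
Qed.

Lemma normr_delta_mx (i : 'I_n) : `|delta_mx ord0 i : 'rV[R]_n| <= 1.
Proof.
rewrite /Num.norm/= mx_normrE; apply: bigmax_le => // -[a b] _.
by rewrite mxE normr_nat; case: (_ && _).
Qed.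

Lemma ler_norm_coord x (i : 'I_n) : `|x ord0 i| <= `|x|.
Proof.
rewrite /Num.norm/= mx_normrE.
exact: (le_bigmax _ (fun p => `|x p.1 p.2|) (ord0, i)).
Qed.

Lemma is_derive_partial f x (i : 'I_n) : Ck 1 f ->
  is_derive x (delta_mx ord0 i) f (partial i f x).
Proof. by move=> [_ /(_ i)[df _]]; split. Qed.

Lemma continuous_partial f (i : 'I_n) : Ck 1 f -> continuous (partial i f).
Proof. by move=> [_ /(_ i)[_ df]]. Qed.

Lemma Ck1I f (df : 'I_n -> 'rV[R]_n -> R) : continuous f ->
  (forall i x, is_derive x (delta_mx ord0 i) f (df i x)) ->
  (forall i, continuous (df i)) -> Ck 1 f.
Proof.
move=> cf dfE cdf; split=> // i; split=> [x|]; first by have [] := dfE i x.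
suff -> : partial i f = df i by exact: cdf.
by apply/funext => x; have [] := dfE i x.
Qed.

Lemma is_derive_partialE f (i : 'I_n) (df : 'rV[R]_n -> R) :
  (forall x, is_derive x (delta_mx ord0 i) f (df x)) -> partial i f = df.
Proof. by move=> dfE; apply/funext => x; have [] := dfE x. Qed.

End line.

Section averaging.
Context {R : realType} {n : nat} (e : R).
Hypothesis e0 : 0 < e.
Implicit Types (f h : 'rV[R]_n -> R) (x v : 'rV[R]_n).
Implicit Types (phi dphi : R -> R) (i j : 'I_n).

(** A one-sided convolution at scale e in the single direction i; composing these over all
    directions gives a mollifier without any multiple integral. *)
Definition avg i phi h x : R :=
  int01 (fun s => phi s * h ((e * s) *: delta_mx ord0 i + x)).

Lemma continuous_avg_integrand i phi h : continuous phi -> continuous h ->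
  continuous (fun p : 'rV[R]_n * R =>
    phi p.2 * h ((e * p.2) *: delta_mx ord0 i + p.1)).
Proof.
move=> cphi ch p; apply: cvgM.
  by apply: (@cvg_comp _ _ _ snd phi); [exact: cvg_snd|exact: cphi].
apply: (@cvg_comp _ _ _
  (fun p : 'rV[R]_n * R => (e * p.2) *: delta_mx ord0 i + p.1) h); last exact: ch.
apply: cvgD; last exact: cvg_fst.
apply: cvgZr_tmp; apply: cvgM; [exact: cvg_cst|exact: cvg_snd].
Qed.

Lemma continuous_avg i phi h : continuous phi -> continuous h ->
  continuous (avg i phi h).
Proof.
move=> cphi ch.
apply: (@continuous_int01 R _
  (fun x s => phi s * h ((e * s) *: delta_mx ord0 i + x))).
exact: continuous_avg_integrand.
Qed.

Lemma continuous_avg1 i phi h x : continuous phi -> continuous h ->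
  continuous (fun s => phi s * h ((e * s) *: delta_mx ord0 i + x)).
Proof.
move=> cphi ch; apply: (continuous_section
  (h := (fun x s => phi s * h ((e * s) *: delta_mx ord0 i + x)))).
exact: continuous_avg_integrand.
Qed.

Lemma avgZ i phi h c : continuous phi -> continuous h ->
  avg i phi (fun y => c * h y) = (fun x => c * avg i phi h x).
Proof.
move=> cphi ch; apply/funext => x; rewrite /avg -int01Zl; last exact: continuous_avg1.
by apply: eq_int01 => s _; ring.
Qed.

Lemma is_derive_avg i j phi h x : continuous phi -> Ck 1 h ->
  is_derive x (delta_mx ord0 j) (avg i phi h) (avg i phi (partial j h) x).
Proof.
move=> cphi ch.
pose g (f : 'rV[R]_n -> R) (t s : R) : R :=
  phi s * f ((e * s) *: delta_mx ord0 i + (t *: delta_mx ord0 j + x)).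
have cg f : continuous f -> continuous (fun p : R * R => g f p.1 p.2).
  move=> cf p; apply: cvgM.
    by apply: (@cvg_comp _ _ _ snd phi); [exact: cvg_snd|exact: cphi].
  apply: (@cvg_comp _ _ _ (fun p : R * R =>
    (e * p.2) *: delta_mx ord0 i + (p.1 *: delta_mx ord0 j + x)) f); last exact: cf.
  apply: cvgD.
    by apply: cvgZr_tmp; apply: cvgM; [exact: cvg_cst|exact: cvg_snd].
  apply: cvgD; last exact: cvg_cst.
  by apply: cvgZr_tmp; exact: cvg_fst.
have dg (t s : R) : is_derive t (1 : R) (fun t => g h t s) (g (partial j h) t s).
  apply: is_deriveZ.
  have := is_derive_partial
    ((e * s) *: delta_mx ord0 i + (t *: delta_mx ord0 j + x)) j ch.
  rewrite addrCA => /is_derive_line.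
  by under eq_fun do rewrite addrCA.
have := @is_derive_int01 R (g h) (g (partial j h)) 0 (cg _ ch.1)
  (cg _ (continuous_partial ch)) dg.
move=> H.
have {}H : is_derive (0 : R) (1 : R)
  (fun t : R => avg i phi h (t *: delta_mx ord0 j + x))
  (avg i phi (partial j h) (0 *: delta_mx ord0 j + x)) by exact: H.
by move/is_derive_line : H; rewrite scale0r add0r.
Qed.

Lemma avg_Ck1 i phi h : continuous phi -> Ck 1 h -> Ck 1 (avg i phi h).
Proof.
move=> cphi ch; apply: (@Ck1I _ _ _ (fun j => avg i phi (partial j h))).
- by apply: continuous_avg => //; exact: ch.1.
- by move=> j x; exact: is_derive_avg.
- by move=> j; apply: continuous_avg => //; exact: continuous_partial.
Qed.

Lemma partial_avg i j phi h : continuous phi -> Ck 1 h ->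
  partial j (avg i phi h) = avg i phi (partial j h).
Proof. by move=> cphi ch; apply: is_derive_partialE => x; exact: is_derive_avg. Qed.

(** Along direction i, [e * partial i h] is the s-derivative of h at the shifted point, hence the
    factor [e^-1]; the boundary terms vanish because kernels vanish at 0 and 1. The derivative is
    carried by the kernel and h loses no regularity. *)
Lemma avg_by_parts i phi dphi h : kern phi -> kern dphi ->
  (forall s : R, 0 < s < 1 -> is_derive s (1 : R) phi (dphi s)) -> Ck 1 h ->
  avg i phi (partial i h) = avg i dphi (fun y => - e^-1 * h y).
Proof.
move=> kphi kdphi dphiE ch; apply/funext => x.
have cphi := kern_continuous kphi; have cdphi := kern_continuous kdphi.
pose G (s : R) := h ((e * s) *: delta_mx ord0 i + x).
pose g (s : R) := e * partial i h ((e * s) *: delta_mx ord0 i + x).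
have caff : continuous (fun s : R => (e * s) *: delta_mx ord0 i + x).
  move=> s; apply: cvgD; last exact: cvg_cst.
  by apply: cvgZr_tmp; apply: cvgM; [exact: cvg_cst|exact: cvg_id].
have cG : continuous G.
  by move=> s; apply: (@cvg_comp _ _ _ _ h); [exact: caff|exact: ch.1].
have cg : continuous g.
  move=> s; apply: cvgM; first exact: cvg_cst.
  apply: (@cvg_comp _ _ _ _ (partial i h)); first exact: caff.
  exact: continuous_partial.
have dG s : is_derive s (1 : R) G (g s).
  have /is_derive_line d1 := is_derive_partial ((e * s) *: delta_mx ord0 i + x) i ch.
  have d2 : is_derive s (1 : R) (fun s : R => e * s) e.
    have := @is_deriveZ _ _ _ id e s 1 1 (is_derive_id _ _).
    by rewrite /GRing.scale/= mulr1.
  by have := is_derive1_comp d1 d2; rewrite mulrC.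
have dphi01 : derivable_oo_LRcontinuous phi 0 1.
  split; first by move=> s; rewrite in_itv/= => /dphiE[].
    exact/cvg_at_right_filter/cphi.
  exact/cvg_at_left_filter/cphi.
have dG01 : derivable_oo_LRcontinuous G 0 1.
  split; first by move=> s _; have [] := dG s.
    exact/cvg_at_right_filter/cG.
  exact/cvg_at_left_filter/cG.
have := @Rintegration_by_parts R phi G dphi g 0 1 ltr01
  (continuous_subspaceT cdphi) dphi01 _ (continuous_subspaceT cg) dG01 _.
rewrite kern0// kern1// !mul0r subrr sub0r => /(_ _ _) H.
have {}H : int01 (fun s => phi s * g s) = - int01 (fun s => dphi s * G s).
  apply: H => s; rewrite in_itv/= derive1E.
    by move=> /dphiE[].
  by move=> _; have [] := dG s.
apply: (@mulfI _ e); first by rewrite gt_eqF.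
rewrite avgZ//; last exact: ch.1.
rewrite mulrA mulrN mulfV ?gt_eqF// mulN1r -[RHS]H.
rewrite -int01Zl; last by apply: continuous_avg1 => //; exact: continuous_partial.
by apply: eq_int01 => s _; rewrite /g; ring.
Qed.

Lemma avg_approx i phi h x c d : continuous phi -> (forall s, 0 <= phi s) ->
  int01 phi = 1 -> continuous h ->
  (forall y, `|y - x| <= e -> `|h y - c| <= d) -> `|avg i phi h x - c| <= d.
Proof.
move=> cphi phi0 phi1 ch hd.
have d0 : 0 <= d.
  by apply: (le_trans (normr_ge0 _) (hd x _)); rewrite subrr normr0 ltW.
have cphiZ k : continuous (fun s => k * phi s).
  by move=> s; apply: cvgM; [exact: cvg_cst|exact: cphi].
have cav := @continuous_avg1 i phi h x cphi ch.
have bnd s : 0 <= s <= 1 ->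
    `|h ((e * s) *: delta_mx ord0 i + x) - c| <= d.
  move=> /andP[s0 s1]; apply: hd; rewrite addrK normrZ.
  rewrite ger0_norm ?mulr_ge0 ?(ltW e0)//.
  rewrite -[leRHS]mulr1 -mulrA ler_pM2l// -[leRHS]mulr1.
  by apply: ler_pM => //; exact: normr_delta_mx.
rewrite ler_distl; apply/andP; split.
- have -> : c - d = int01 (fun s => (c - d) * phi s) by rewrite int01Zl// phi1 mulr1.
  apply: ler_int01 => // s /bnd; rewrite ler_distl => /andP[h1 _].
  by rewrite mulrC ler_wpM2l.
- have -> : c + d = int01 (fun s => (c + d) * phi s) by rewrite int01Zl// phi1 mulr1.
  apply: ler_int01 => // s /bnd; rewrite ler_distl => /andP[_ h1].
  by rewrite [leRHS]mulrC ler_wpM2l.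
Qed.

End averaging.

Arguments Ck : simpl never.

Section mollification.
Context {R : realType} {n : nat} (e : R).
Hypothesis e0 : 0 < e.
Implicit Types (f h : 'rV[R]_n -> R) (x v : 'rV[R]_n).
Implicit Types (phi dphi : R -> R) (i j : 'I_n).
Implicit Type l : seq ('I_n * (R -> R)).

(* Each derivative of moll l h falls on one of the kernels, by parts, so that h
   need only be of class C^1. *)
Definition moll l h : 'rV[R]_n -> R := foldr (fun p => avg e p.1 p.2) h l.

Definition all_kern l := foldr (fun p P => kern p.2 /\ P) True l.

Lemma continuous_moll l h : all_kern l -> continuous h -> continuous (moll l h).
Proof.
elim: l => //= -[i phi] l IHl [/kern_continuous cphi /IHl{}IHl] ch.
by apply: continuous_avg => //; exact: IHl.
Qed.

Lemma mollZ l h c : all_kern l -> continuous h ->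
  moll l (fun y => c * h y) = (fun x => c * moll l h x).
Proof.
elim: l => //= -[i phi] l IHl [/kern_continuous cphi lk] ch.
by rewrite IHl//= avgZ//; exact: continuous_moll.
Qed.

Lemma moll_Ck1 l h : all_kern l -> Ck 1 h -> Ck 1 (moll l h).
Proof.
elim: l => //= -[i phi] l IHl [/kern_continuous cphi lk] ch.
by apply: avg_Ck1 => //; exact: IHl.
Qed.

Lemma partial_moll j l h : all_kern l -> Ck 1 h ->
  partial j (moll l h) = moll l (partial j h).
Proof.
elim: l => //= -[i phi] l IHl [/kern_continuous cphi lk] ch.
by rewrite partial_avg//= ?IHl//; exact: moll_Ck1.
Qed.

(** The derivative passes through the averages until the first one in direction j, whose kernel
    absorbs it. The list of directions is unchanged and h is only rescaled, so the step can be
    iterated. *)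
Lemma partial_moll_mem j l h : all_kern l -> Ck 1 h -> j \in map fst l ->
  exists l', [/\ all_kern l', map fst l' = map fst l &
    partial j (moll l h) = moll l' (fun y => - e^-1 * h y)].
Proof.
elim: l => //= -[i phi] l IHl [/= kphi lk] ch; rewrite inE.
have cphi := kern_continuous kphi.
have [-> _|ji /= jl] := eqVneq j i.
  have [dphi kdphi dphiE] := kern_derive kphi.
  exists ((i, dphi) :: l); split => //=.
  rewrite partial_avg//; last exact: moll_Ck1.
  rewrite (avg_by_parts e0 i kphi kdphi)//; last exact: moll_Ck1.
  by rewrite mollZ//; exact: ch.1.
have [l' [l'k l'E dE]] := IHl lk ch jl.
exists ((i, phi) :: l'); split => //=; first by rewrite l'E.
by rewrite partial_avg// ?dE//; exact: moll_Ck1.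
Qed.

Lemma Ck1Z c h : Ck 1 h -> Ck 1 (fun y => c * h y).
Proof.
move=> ch; apply: (@Ck1I _ _ _ (fun j y => c * partial j h y)).
- by apply: continuous_mulf; [exact: cst_continuous|exact: ch.1].
- by move=> j x; apply: is_deriveZ; exact: is_derive_partial.
- move=> j; apply: continuous_mulf; first exact: cst_continuous.
  exact: continuous_partial.
Qed.

Lemma moll_smooth l h : all_kern l -> Ck 1 h -> (forall j, j \in map fst l) ->
  smooth (moll l h).
Proof.
(* Kernels and h are generalized, since each differentiation replaces both; only the set of
   directions is invariant. *)
move=> + + + k; elim: k l h => [|k IHk] l h lk ch jl.
  by apply: continuous_moll => //; exact: ch.1.
split; first by apply: continuous_moll => //; exact: ch.1.
move=> i; split; first exact: ((moll_Ck1 lk ch).2 i).1.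
have [l' [l'k l'E ->]] := partial_moll_mem lk ch (jl i).
by apply: IHk => //; [exact: Ck1Z|rewrite l'E].
Qed.

Definition mollify phi : ('rV[R]_n -> R) -> 'rV[R]_n -> R :=
  moll [seq (i, phi) | i <- enum 'I_n].

Section unit_kernel.
Variable phi : R -> R.
Hypothesis (kphi : kern phi) (phi0 : forall s, 0 <= phi s) (phi1 : int01 phi = 1).

Lemma all_kern_map (s : seq 'I_n) : all_kern [seq (i, phi) | i <- s].
Proof. by elim: s => //= i s IHs. Qed.

Lemma mollify_smooth h : Ck 1 h -> smooth (mollify phi h).
Proof.
move=> ch; apply: moll_smooth => //; first exact: all_kern_map.
by move=> j; rewrite -map_comp map_id mem_enum.
Qed.

Lemma partial_mollify j h : Ck 1 h ->
  partial j (mollify phi h) = mollify phi (partial j h).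
Proof. by move=> ch; rewrite partial_moll//; exact: all_kern_map. Qed.

(** Each of the n averages moves the point by at most e in the sup norm and is taken against a
    probability density, so bounds on the ball of radius e n survive. *)
Lemma mollify_approx h x c d : continuous h ->
  (forall y, `|y - x| <= e * n%:R -> `|h y - c| <= d) ->
  `|mollify phi h x - c| <= d.
Proof.
move=> ch; rewrite /mollify -[X in e * X%:R](size_enum_ord n).
elim: (enum _) x => [|i s IHs] x hd /=.
  by apply: hd; rewrite subrr normr0 mulr0.
apply: avg_approx => //.
- exact: kern_continuous.
- by apply: continuous_moll => //; exact: all_kern_map.
move=> y yx; apply: IHs => z zy; apply: hd.
rewrite -(subrKA y) (le_trans (ler_normD _ _))//=.
by rewrite -natr1 mulrDr mulr1 lerD.
Qed.

End unit_kernel.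

End mollification.

(** * Polynomial growth of functions of class C^1 *)

Section growth.
Context {R : realType} {n : nat}.
Implicit Types (f h : 'rV[R]_n -> R) (x : 'rV[R]_n).

Lemma ler_norm_rV x (r : R) : 0 <= r -> (forall i, `|x ord0 i| <= r) -> `|x| <= r.
Proof.
move=> r0 xr; rewrite /Num.norm/= mx_normrE; apply: bigmax_le => // -[a b] _ /=.
by rewrite (ord1 a).
Qed.

(* Moves from 0 to x one coordinate at a time, staying in the ball of radius
   `|x|. *)
Lemma ler_dist0_Ck1 h x (B : R) : Ck 1 h ->
  (forall i y, `|y| <= `|x| -> `|partial i h y| <= B) ->
  `|h x - h 0| <= n%:R * (B * `|x|).
Proof.
move=> ch hB.
pose pr (s : seq 'I_n) : 'rV[R]_n := \row_j (if j \in s then x ord0 j else 0).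
have H (s : seq 'I_n) : `|h (pr s) - h 0| <= (size s)%:R * (B * `|x|).
  elim: s => [|i s IHs].
    rewrite mul0r (_ : pr [::] = 0) ?subrr ?normr0//.
    by apply/rowP => j; rewrite !mxE.
  have [iS|iS] := boolP (i \in s).
    have -> : pr (i :: s) = pr s.
      by apply/rowP => j; rewrite !mxE inE; have [->|] := eqVneq; rewrite ?iS.
    rewrite (le_trans IHs)// /= -natr1 mulrDl mul1r lerDl mulr_ge0//.
    by apply: le_trans (hB i 0 _); rewrite ?normr0.
  have bnd (t : R) : 0 <= t <= 1 ->
      `|(t * x ord0 i) *: delta_mx ord0 i + pr s| <= `|x|.
    move=> /andP[t0 t1]; apply: ler_norm_rV => // j; rewrite !mxE/=.
    have [->|ji] := eqVneq j i.
      rewrite (negbTE iS) mulr1 addr0 normrM ger0_norm//.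
      by rewrite (le_trans _ (ler_norm_coord x i))// ler_piMl.
    by rewrite mulr0 add0r; case: ifP => // _; rewrite ?normr0// ler_norm_coord.
  pose g (t : R) := h ((t * x ord0 i) *: delta_mx ord0 i + pr s).
  have dg (t : R) : is_derive t (1 : R) g
      (partial i h ((t * x ord0 i) *: delta_mx ord0 i + pr s) * x ord0 i).
    have /is_derive_line d1 := is_derive_partial
      ((t * x ord0 i) *: delta_mx ord0 i + pr s) i ch.
    have d2 : is_derive t (1 : R) (fun s : R => s * x ord0 i) (x ord0 i).
      have -> : (fun s : R => s * x ord0 i) = x ord0 i \*: id.
        by apply/funext => s'; rewrite mulrC.
      have := @is_deriveZ _ _ _ id (x ord0 i) t 1 1 (is_derive_id _ _).
      by rewrite /GRing.scale/= mulr1.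
    exact: (@is_derive1_comp R (fun u : R => h (u *: delta_mx ord0 i + pr s))
      (fun s : R => s * x ord0 i) t _ _ d1 d2).
  have cg : {within `[0, 1], continuous g}.
    by apply: derivable_within_continuous => t _; have [] := dg t.
  have [c c01] := MVT ltr01 (fun t _ => dg t) cg.
  rewrite subr0 mulr1 /g mul0r scale0r add0r mul1r => E.
  have -> : pr (i :: s) = x ord0 i *: delta_mx ord0 i + pr s.
    apply/rowP => j; rewrite !mxE inE/=; have [->|ji] := eqVneq j i.
      by rewrite (negbTE iS) mulr1 addr0.
    by rewrite mulr0 add0r.
  rewrite -(subrKA (h (pr s))) E (le_trans (ler_normD _ _))//=.
  rewrite -natr1 mulrDl mul1r addrC lerD// normrM.
  apply: ler_pM => //; last exact: ler_norm_coord.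
  by apply/hB/bnd; move: c01; rewrite in_itv/= => /andP[/ltW -> /ltW ->].
have := H (enum 'I_n); rewrite size_enum_ord.
by rewrite (_ : pr _ = x)//; apply/rowP => j; rewrite mxE mem_enum.
Qed.

Lemma growth_Ck1 h (C : R) (q : nat) : Ck 1 h ->
  (forall i x, `|partial i h x| <= C * (1 + `|x|) ^+ q) ->
  exists C', forall x, `|h x| <= C' * (1 + `|x|) ^+ q.+1.
Proof.
move=> ch hC; exists (`|h 0| + n%:R * `|C|) => x.
have w1 : 1 <= 1 + `|x| by rewrite lerDl.
have w0 : 0 <= 1 + `|x| by apply: le_trans w1.
have H := @ler_dist0_Ck1 h x (`|C| * (1 + `|x|) ^+ q) ch _.
rewrite -[h x](subrK (h 0)) (le_trans (ler_normD _ _))// mulrDl addrC lerD//.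
  by rewrite ler_peMr// exprn_ege1.
rewrite (le_trans (H _))//; last first.
  rewrite -!mulrA ler_wpM2l// ler_wpM2l// exprSr ler_wpM2l ?exprn_ge0//.
  by rewrite lerDr.
move=> i y yx; rewrite (le_trans (hC i y))//.
apply: (@le_trans _ _ (`|C| * (1 + `|y|) ^+ q)).
  by rewrite ler_wpM2r ?ler_norm// exprn_ge0// addr_ge0.
by rewrite ler_wpM2l// lerXn2r ?nnegrE ?addr_ge0// lerD2l.
Qed.

End growth.

(** * Moments and the extension to functions of class C^1 *)

Section measurability.
Context {R : realType} {n : nat}.

Lemma continuous_measurable_rV (h : 'rV[R]_n -> R) : continuous h ->
  measurable_fun [set: 'rV[R]_n] h.
Proof.
move=> /continuousP ch.
apply: (measurability _ (measurable_realfun.RGenOpens.measurableE R)).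
move=> _ [_ [a [b ->] <-]]; rewrite setTI.
by apply: sub_sigma_algebra; apply: ch; exact: interval_open.
Qed.

Lemma continuous_measurable_EFin (h : 'rV[R]_n -> R) : continuous h ->
  measurable_fun [set: 'rV[R]_n] (EFin \o h).
Proof. by move=> ch; apply/measurable_EFinP; apply: continuous_measurable_rV. Qed.

Lemma continuous_coord (i : 'I_n) : continuous (fun x : 'rV[R]_n => x ord0 i).
Proof. exact: coord_continuous. Qed.

(** The power is derivable only away from 0, so the origin is handled by hand, with the radius
    e^(1/p). *)
Lemma continuous_powR (p : R) : 0 < p -> continuous (fun x : R => `|x| `^ p).
Proof.
move=> p0 x; have [->|x0] := eqVneq x 0.
  apply/cvgrPdist_lt => e e0; rewrite normr0 powR0 ?gt_eqF//.
  near=> y; rewrite sub0r normrN ger0_norm ?powR_ge0//.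
  have eE : (e `^ p^-1) `^ p = e.
    by rewrite -powRrM mulVf ?gt_eqF// powRr1// ltW.
  rewrite -[ltRHS]eE.
  apply: gt0_ltr_powR; rewrite ?nnegrE ?powR_ge0//.
  near: y; exists (e `^ p^-1) => [|z]; first by rewrite /= powR_gt0.
  by rewrite /= sub0r normrN.
apply: (@cvg_comp _ _ _ (@Num.norm _ R) (fun y => y `^ p)).
  by apply: cvg_norm; exact: cvg_id.
have nx : `|x| \in `]0, +oo[ by rewrite in_itv/= normr_gt0 x0.
have /derivable1_diffP/differentiable_continuous := @derivable_powR R 1 p _ nx.
exact.
Unshelve. all: by end_near. Qed.

End measurability.

Section smooth_coordinates.
Context {R : realType} {n : nat}.

Lemma smooth_cst (c : R) : smooth (fun _ : 'rV[R]_n => c).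
Proof.
move=> k; elim: k c => [|k IHk] c; first exact: cst_continuous.
split; first exact: cst_continuous.
move=> i; split=> [x|].
  by have [] := is_derive_cst c x (delta_mx ord0 i : 'rV[R]_n).
by rewrite (is_derive_partialE (df := fun=> 0)) // => x; exact: is_derive_cst.
Qed.

Lemma is_derive_coord (i j : 'I_n) (x : 'rV[R]_n) :
  is_derive x (delta_mx ord0 j) (fun y : 'rV[R]_n => y ord0 i) (i == j)%:R.
Proof.
rewrite -[x]add0r -[X in X + x](scale0r (delta_mx ord0 j)).
apply/is_derive_line.
have -> : (fun t : R => (t *: delta_mx ord0 j + x) ord0 i) =
    (fun t : R => (i == j)%:R * t) + cst (x ord0 i).
  by apply/funext => t; rewrite !mxE/= mulrC.
rewrite -[X in is_derive _ _ _ X]addr0; apply: is_deriveD.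
have := @is_deriveZ _ _ _ id (i == j)%:R (0 : R) 1 1 (is_derive_id _ _).
by rewrite /GRing.scale/= mulr1.
Qed.

Lemma smooth_coord (i : 'I_n) : smooth (fun x : 'rV[R]_n => x ord0 i).
Proof.
case=> [|k]; first exact: continuous_coord.
split; first exact: continuous_coord.
move=> j; split=> [x|]; first by have [] := is_derive_coord i j x.
rewrite (is_derive_partialE (is_derive_coord i j)).
exact: smooth_cst.
Qed.

End smooth_coordinates.

Section moments.
Context {R : realType} {n : nat} (mu : probability 'rV[R]_n R).
Implicit Types (g h : 'rV[R]_n -> R).
Local Open Scope ereal_scope.

Lemma measurable_norm_powR (p : R) g : measurable_fun setT g ->
  measurable_fun setT (fun x => (`|g x| `^ p)%:E).
Proof.
move=> mg; apply/measurable_EFinP.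
apply: (measurableT_comp (measurable_powR _)) => //.
exact: measurableT_comp.
Qed.

Lemma LnormE (p : R) g :
  'N[mu]_p%:E[EFin \o g] = (\int[mu]_x (`|g x| `^ p)%:E) `^ p^-1.
Proof. by rewrite unlock; congr poweR; apply: eq_integral. Qed.

Lemma Lnorm_cst (p c : R) : (0 < p)%R -> 'N[mu]_p%:E[EFin \o cst c] = `|c|%:E.
Proof.
move=> p0; rewrite LnormE/= integral_cst//= probability_setT mule1 poweR_EFin.
by rewrite -powRrM mulfV ?gt_eqF// powRr1.
Qed.

Lemma ge0_Lnorm_le (p : R) g h : (0 < p)%R -> continuous g -> continuous h ->
  (forall x, (`|g x| <= `|h x|)%R) ->
  'N[mu]_p%:E[EFin \o g] <= 'N[mu]_p%:E[EFin \o h].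
Proof.
move=> p0 cg ch gh; rewrite !LnormE.
have m (f : 'rV[R]_n -> R) (cf : continuous f) :=
  measurable_norm_powR p (continuous_measurable_rV cf).
have ge (f : 'rV[R]_n -> R) : 0 <= \int[mu]_x (`|f x| `^ p)%:E.
  by apply: integral_ge0 => x _; rewrite lee_fin powR_ge0.
apply: gt0_ler_poweR; rewrite ?invr_ge0 ?(ltW p0)// ?in_itv/= ?ge ?leey//.
apply: ge0_le_integral => //; [exact: m|exact: m|].
by move=> x _; rewrite lee_fin ge0_ler_powR ?nnegrE ?(ltW p0).
Qed.

(** Continuity is bundled in to supply the measurability that Minkowski's inequality requires. *)
Definition Lp (p : R) g := continuous g /\ 'N[mu]_p%:E[EFin \o g] < +oo.

Lemma LpD (p : R) g h : (1 <= p)%R -> Lp p g -> Lp p h -> Lp p (g \+ h)%R.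
Proof.
move=> p1 [cg lg] [ch lh]; split; first exact: continuous_addf.
apply: le_lt_trans (minkowski_EFin _ _ _ p1) _; [exact: continuous_measurable_rV..|].
exact: lte_add_pinfty.
Qed.

Lemma Lp_cst (p c : R) : (1 <= p)%R -> Lp p (cst c).
Proof.
move=> p1; split; first exact: cst_continuous.
by rewrite Lnorm_cst ?ltry// (lt_le_trans ltr01).
Qed.

Lemma Lp_norm (p : R) g : Lp p g -> Lp p (fun x => `|g x|%R).
Proof.
move=> [cg lg]; split; first exact: continuous_normf.
rewrite (_ : _ \o _ = abse \o (EFin \o g)) ?Lnorm_abse//.
Qed.

Lemma Lp_sum (p : R) (I : Type) (s : seq I) (g : I -> 'rV[R]_n -> R) :
  (1 <= p)%R -> (forall i, Lp p (g i)) -> Lp p (fun x => \sum_(i <- s) g i x)%R.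
Proof.
move=> p1 Lg; elim: s => [|i s IHs].
  rewrite (_ : (fun x => _) = cst 0%R); first exact: Lp_cst.
  by apply/funext => x; rewrite big_nil.
rewrite (_ : (fun x => _) = g i \+ (fun x => \sum_(i <- s) g i x))%R.
  exact: LpD.
by apply/funext => x; rewrite big_cons.
Qed.

Lemma Lp_le (p : R) g h : (1 <= p)%R -> continuous g -> Lp p h ->
  (forall x, (`|g x| <= `|h x|)%R) -> Lp p g.
Proof.
move=> p1 cg [ch lh] gh; split => //; apply: le_lt_trans lh.
by apply: ge0_Lnorm_le => //; exact: lt_le_trans p1.
Qed.

Lemma Lp_integrable (p : R) g : (0 < p)%R -> Lp p g ->
  mu.-integrable setT (fun x => (`|g x| `^ p)%:E).
Proof.
move=> p0 [cg lg]; apply/integrableP; split.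
  by apply: measurable_norm_powR; exact: continuous_measurable_rV.
under eq_integral do rewrite gee0_abs ?lee_fin ?powR_ge0//.
rewrite -[X in X < _]poweRe1; last first.
  by apply: integral_ge0 => x _; rewrite lee_fin powR_ge0.
rewrite -(mulVf (lt0r_neq0 p0)) poweRrM -LnormE.
exact: poweR_lty.
Qed.

End moments.

Section growth_integrability.
Context {R : realType} {n : nat} (mu : probability 'rV[R]_n R) (L : R).
Implicit Types (g h : 'rV[R]_n -> R).

Definition poincare_for (p : R) g : Prop :=
  ('N[mu]_(p%:E)[EFin \o (fun x => g x - mean mu g)%R] <=
   (L * Num.sqrt p)%:E * 'N[mu]_(p%:E)[EFin \o (fun x => enorm (grad g x))])%E.

Hypothesis poincare_smooth : forall (p : R) g, 2 <= p -> smooth g -> poincare_for p g.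

Definition growth g :=
  exists (C : R) (q : nat), forall x, `|g x| <= C * (1 + `|x|) ^+ q.

(** A coordinate has constant gradient, so the right-hand side of the moment inequality is finite
    and the centred coordinate lies in L^p. *)
Lemma Lp_coord (p : R) (i : 'I_n) : 2 <= p -> Lp mu p (fun x => x ord0 i).
Proof.
move=> p2; have p1 : 1 <= p by rewrite (le_trans _ p2)// ler1n.
have p0 : 0 < p by exact: lt_le_trans p1.
(* Integrability of the coordinate is still unknown here, so m might be the default value 0; any
   real constant can be added back. *)
pose m := mean mu (fun x : 'rV[R]_n => x ord0 i).
rewrite (_ : (fun x => _) =
    ((fun x : 'rV[R]_n => x ord0 i - m) \+ cst m)%R); last first.
  by apply/funext => x /=; rewrite subrK.
apply: LpD => //; last exact: Lp_cst.
split.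
  by apply: continuous_subf; [exact: continuous_coord|exact: cst_continuous].
have := poincare_smooth p2 (smooth_coord i).
move=> /le_lt_trans; apply.
have -> : (fun x => enorm (grad (fun x : 'rV[R]_n => x ord0 i) x)) =
    cst (enorm (\row_j (i == j)%:R : 'rV[R]_n)).
  apply/funext => x /=; congr enorm; apply/rowP => j; rewrite !mxE.
  by rewrite (is_derive_partialE (is_derive_coord i j)).
by rewrite Lnorm_cst// -EFinM ltry.
Qed.

Let W (x : 'rV[R]_n) : R := 1 + `|x|.

Let W1 x : 1 <= W x. Proof. by rewrite lerDl. Qed.
Let W0 x : 0 <= W x. Proof. exact: le_trans (W1 x). Qed.

Lemma continuous_weight : continuous W.
Proof. by apply: continuous_addf; [exact: cst_continuous|exact: norm_continuous]. Qed.

Lemma Lp_weight (p : R) : 2 <= p -> Lp mu p W.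
Proof.
move=> p2; have p1 : 1 <= p by rewrite (le_trans _ p2)// ler1n.
have L1 : Lp mu p (cst 1 \+ (fun x => \sum_(i < n) `|x ord0 i|)).
  apply: LpD => //; first exact: Lp_cst.
  by apply: Lp_sum => // i; apply: Lp_norm; exact: Lp_coord.
apply: Lp_le L1 _ => //; first exact: continuous_weight.
move=> x /=; have S0 : 0 <= \sum_(i < n) `|x ord0 i| by exact: sumr_ge0.
rewrite !ger0_norm ?addr_ge0// lerD2l.
apply: ler_norm_rV => // i.
by rewrite (bigD1 i)//= lerDl sumr_ge0.
Qed.

Lemma integrable_weight (q : nat) : mu.-integrable setT (EFin \o (fun x => W x ^+ q)).
Proof.
(* The exponent is raised to q + 2 because the moments are available from 2 on; the weight is at
   least 1, so its q-th power is dominated. *)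
have q2 : (2 : R) <= (q.+2)%:R by rewrite ler_nat.
have q0 : (0 : R) < (q.+2)%:R by rewrite ltr0n.
have iW := Lp_integrable q0 (Lp_weight q2).
apply: le_integrable iW => //.
  apply: continuous_measurable_EFin.
  exact: (@continuous_expf _ _ W _ continuous_weight).
move=> x _ /=. rewrite lee_fin powR_mulrn// !ger0_norm ?exprn_ge0//.
by rewrite ler_weXn2l// -addn2 leq_addr.
Qed.

Lemma growth_integrable h : continuous h -> growth h ->
  mu.-integrable setT (EFin \o h).
Proof.
move=> ch [C [q hC]].
have i1 : mu.-integrable setT (fun x => (`|C|%:E * (W x ^+ q)%:E)%E).
  exact/integrableZl/integrable_weight.
apply: le_integrable i1 => //; first exact: continuous_measurable_EFin.
move=> x _ /=; rewrite lee_fin [leRHS]ger0_norm ?mulr_ge0 ?exprn_ge0//.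
by rewrite (le_trans (hC x))// ler_wpM2r ?exprn_ge0// ler_norm.
Qed.

(** Dominated convergence, the majorant being a multiple of the integrable weight. *)
Lemma growth_cvg (h_ : nat -> 'rV[R]_n -> R) h (C : R) (q : nat) :
  (forall k, continuous (h_ k)) -> continuous h ->
  (forall k x, `|h_ k x| <= C * (1 + `|x|) ^+ q) ->
  (forall x, h_ k x @[k --> \oo] --> h x) ->
  ((\int[mu]_x (h_ k x)%:E)%E @[k --> \oo] --> (\int[mu]_x (h x)%:E)%E).
Proof.
move=> ch_ ch hC hcvg.
have i1 : mu.-integrable setT (fun x => (`|C|%:E * (W x ^+ q)%:E)%E).
  exact/integrableZl/integrable_weight.
have [] := @dominated_convergence _ _ _ mu setT measurableT
  (fun k x => (h_ k x)%:E) (EFin \o h) (fun x => (`|C|%:E * (W x ^+ q)%:E)%E)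
  _ _ _ i1 _ => //.
- by move=> k; apply: continuous_measurable_EFin.
- exact: continuous_measurable_EFin.
- apply: aeW => x _; apply: cvg_EFin; first exact: nearW.
  exact: hcvg.
- apply: aeW => x k _; rewrite lee_fin (le_trans (hC k x))//.
  by rewrite ler_wpM2r ?exprn_ge0// ler_norm.
Qed.

Lemma growth_mean_cvg (h_ : nat -> 'rV[R]_n -> R) h (C : R) (q : nat) :
  (forall k, continuous (h_ k)) -> continuous h ->
  (forall k x, `|h_ k x| <= C * (1 + `|x|) ^+ q) ->
  (forall x, h_ k x @[k --> \oo] --> h x) ->
  mean mu (h_ k) @[k --> \oo] --> mean mu h.
Proof.
move=> ch_ ch hC hcvg.
have gh : growth h.
  exists C, q => x; have /(cvg_norm) := hcvg x.
  by move=> hx; apply: (cvgr_to_le hx); apply: nearW => k; exact: hC.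
apply: fine_cvg; rewrite fineK; first exact: (growth_cvg ch_ ch hC hcvg).
by apply: integrable_fin_num => //; exact: growth_integrable.
Qed.

(** The weight is at least 1, so p may be replaced by a larger integer. The new constants come
    before [h] so as to serve a whole sequence of functions. *)
Lemma growth_powR (p C : R) (q : nat) : 0 < p -> exists (C' : R) (q' : nat),
  forall h x, `|h x| <= C * (1 + `|x|) ^+ q -> `|h x| `^ p <= C' * (1 + `|x|) ^+ q'.
Proof.
move=> p0; have [m pm] : exists m : nat, p <= m%:R.
  by exists (Num.Def.archi_bound p); rewrite ltW// archi_boundP// ltW.
exists (`|C| `^ p), (q * m)%N => h x hx.
have Wq1 : 1 <= W x ^+ q by exact: exprn_ege1.
apply: (@le_trans _ _ ((`|C| * W x ^+ q) `^ p)).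
  apply: ge0_ler_powR; rewrite ?nnegrE ?(ltW p0) ?mulr_ge0 ?exprn_ge0//.
  by rewrite (le_trans hx)// ler_wpM2r ?exprn_ge0// ler_norm.
rewrite powRM ?exprn_ge0// ler_wpM2l ?powR_ge0// exprM.
by rewrite -[leRHS]powR_mulrn ?exprn_ge0// ler_powR.
Qed.

End growth_integrability.

Section euclidean_norm.
Context {R : realType} {n : nat}.
Implicit Types u v : 'rV[R]_n.

Lemma enorm_ge0 v : 0 <= enorm v. Proof. exact: sqrtr_ge0. Qed.

Lemma enorm_sqr v : enorm v ^+ 2 = \sum_i v ord0 i ^+ 2.
Proof. by rewrite sqr_sqrtr// sumr_ge0// => i _; exact: sqr_ge0. Qed.

Lemma enorm_le_sum v : enorm v <= \sum_i `|v ord0 i|.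
Proof.
have S0 : 0 <= \sum_i `|v ord0 i| by exact: sumr_ge0.
rewrite -(ler_pXn2r (ltn0Sn 1)) ?nnegrE ?enorm_ge0// enorm_sqr expr2 mulr_suml.
apply: ler_sum => i _; rewrite -normr_id -real_normK ?num_real// expr2.
by rewrite normr_id ler_wpM2l// (bigD1 i)//= lerDl sumr_ge0.
Qed.

Lemma continuous_enorm_grad (g : 'rV[R]_n -> R) : Ck 1 g ->
  continuous (fun x => enorm (grad g x)).
Proof.
move=> cg; apply: continuous_sqrtf; apply: continuous_sumf => i.
apply: continuous_expf; rewrite (_ : (fun x => _) = partial i g); last first.
  by apply/funext => x; rewrite mxE.
exact: continuous_partial.
Qed.

End euclidean_norm.

(** * Convergence and uniform growth of the mollifications *)

Section mollify_limit.
Context {R : realType} {n : nat}.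
Variable phi : R -> R.
Hypothesis (kphi : kern phi) (phi0 : forall s, 0 <= phi s) (phi1 : int01 phi = 1).
Implicit Types h : 'rV[R]_n -> R.

Let e_ (k : nat) : R := k.+1%:R^-1.
Let e_gt0 k : 0 < e_ k. Proof. by rewrite invr_gt0 ltr0n. Qed.
Let e_le1 k : e_ k <= 1. Proof. by rewrite invf_le1 ?ltr0n// ler1n. Qed.

Lemma mollify_cvg h (x : 'rV[R]_n) : continuous h ->
  mollify (e_ k) phi h x @[k --> \oo] --> h x.
Proof.
move=> ch; apply/cvgrPdist_le => d d0.
have /cvgrPdist_le/(_ _ d0)/nbhs_normP[r /= r0 rd] := ch x.
(* The averages reach as far as n times the scale; dividing by n + 1 keeps the case n = 0
   meaningful. *)
have nd : 0 < r / n.+1%:R by rewrite divr_gt0// ltr0n.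
have /cvgrPdist_lt/(_ _ nd)[N _ HN] := @cvg_harmonic R.
exists N => // k /HN; rewrite /= sub0r normrN gtr0_norm ?invr_gt0 ?ltr0n// => ek.
rewrite distrC; apply: (mollify_approx (e_gt0 k)) => // y yx.
rewrite distrC; apply: rd => /=; rewrite distrC (le_lt_trans yx)//.
rewrite ltr_pdivlMr ?ltr0n// in ek; apply: le_lt_trans ek.
by rewrite ler_wpM2l ?(ltW (e_gt0 k))// ler_nat.
Qed.

Lemma mollify_growth h (C : R) (q : nat) : 0 <= C -> continuous h ->
  (forall x, `|h x| <= C * (1 + `|x|) ^+ q) ->
  forall k x, `|mollify (e_ k) phi h x| <= C * n.+1%:R ^+ q * (1 + `|x|) ^+ q.
Proof.
move=> C0 ch hC k x; rewrite -[X in `|X|]subr0.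
apply: (mollify_approx (e_gt0 k)) => // y yx; rewrite subr0 (le_trans (hC y))//.
rewrite -mulrA -exprMn ler_wpM2l// lerXn2r ?nnegrE ?mulr_ge0 ?addr_ge0//.
(* The scale is at most 1, so 1 + |y| <= (n + 1) (1 + |x|), whatever the index k. *)
have : `|y| <= `|x| + n%:R.
  rewrite -[y](subrK x) addrC (le_trans (ler_normD _ _))// lerD2l.
  by rewrite (le_trans yx)// ler_piMl.
rewrite -natr1; have := mulr_ge0 (ler0n R n) (normr_ge0 x); nra.
Qed.

End mollify_limit.

Section extension.
Context {R : realType} {n : nat} (mu : probability 'rV[R]_n R) (L : R).
Hypothesis L0 : 0 < L.
Hypothesis poincare_smooth :
  forall (p : R) (g : 'rV[R]_n -> R), 2 <= p -> smooth g -> poincare_for mu L p g.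

(** Raising to the power p, monotone on nonnegative extended reals, replaces norms by integrals, to
    which dominated convergence applies directly. *)
Lemma poincare_forE (p : R) (g : 'rV[R]_n -> R) : 0 < p ->
  poincare_for mu L p g <->
  (\int[mu]_x (`|g x - mean mu g| `^ p)%:E <=
   ((L * Num.sqrt p) `^ p)%:E * \int[mu]_x (`|enorm (grad g x)| `^ p)%:E)%E.
Proof.
move=> p0; rewrite /poincare_for !LnormE.
have K0 : 0 <= L * Num.sqrt p by rewrite mulr_ge0 ?sqrtr_ge0// ltW.
have ge0 (h : 'rV[R]_n -> R) : (0 <= \int[mu]_x (`|h x| `^ p)%:E)%E.
  by apply: integral_ge0 => x _; rewrite lee_fin powR_ge0.
have pV0 : 0 <= p^-1 by rewrite invr_ge0 ltW.
have pneq0 := lt0r_neq0 p0.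
split=> H.
- have := gt0_ler_poweR (ltW p0) _ _ H.
  rewrite !in_itv/= !leey !andbT mule_ge0 ?poweR_ge0 ?lee_fin// => /(_ isT isT).
  rewrite poweRM ?poweR_ge0 ?lee_fin// -!poweRrM mulVf// !poweRe1 ?ge0//.
- have := gt0_ler_poweR pV0 _ _ H.
  rewrite !in_itv/= !leey !andbT mule_ge0 ?ge0 ?lee_fin ?powR_ge0// => /(_ isT isT).
  rewrite poweRM ?ge0 ?lee_fin ?powR_ge0// poweR_EFin -powRrM mulfV// powRr1//.
Qed.

Lemma poincare_C1 (p : R) (g : 'rV[R]_n -> R) (C : R) (q : nat) : 2 <= p -> Ck 1 g ->
  (forall i x, `|partial i g x| <= C * (1 + `|x|) ^+ q) ->
  poincare_for mu L p g.
Proof.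
move=> p2 cg gC; have p0 : 0 < p by exact: lt_le_trans p2.
have {gC} gC i x : `|partial i g x| <= `|C| * (1 + `|x|) ^+ q.
  by rewrite (le_trans (gC i x))// ler_wpM2r ?ler_norm// exprn_ge0// addr_ge0.
have [C1 {}gC1] := growth_Ck1 cg gC.
have {gC1} gC1 x : `|g x| <= `|C1| * (1 + `|x|) ^+ q.+1.
  by rewrite (le_trans (gC1 x))// ler_wpM2r ?ler_norm// exprn_ge0// addr_ge0.
have [phi kphi [phi0 phi1]] := exists_unit_kern R.
pose e_ (k : nat) : R := k.+1%:R^-1.
have e0 k : 0 < e_ k by rewrite invr_gt0 ltr0n.
pose g_ k := mollify (e_ k) phi g.
have sg k : smooth (g_ k) by exact: mollify_smooth.
have cg_ k : continuous (g_ k) := sg k 0%N.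
have g_cvg x : g_ k x @[k --> \oo] --> g x by apply: mollify_cvg => //; exact: cg.1.
have g_bnd k x : `|g_ k x| <= (`|C1| * n.+1%:R ^+ q.+1) * (1 + `|x|) ^+ q.+1.
  by apply: mollify_growth => //; exact: cg.1.
have dg_cvg i x : partial i (g_ k) x @[k --> \oo] --> partial i g x.
  under eq_fun do rewrite partial_mollify//.
  by apply: mollify_cvg => //; exact: continuous_partial.
have dg_bnd i k x : `|partial i (g_ k) x| <= (`|C| * n.+1%:R ^+ q) * (1 + `|x|) ^+ q.
  rewrite partial_mollify//.
  by apply: mollify_growth => //; exact: continuous_partial.
have m_cvg := growth_mean_cvg poincare_smooth cg_ cg.1 g_bnd g_cvg.
have W1 (x : 'rV[R]_n) : 1 <= 1 + `|x| by rewrite lerDl.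
(* The means vary with k; as a convergent sequence they are bounded, which gives the centred
   mollifications a common majorant. *)
have [M HM] : exists M, forall k, `|mean mu (g_ k)| <= M.
  have /cvg_seq_bounded[M [_ HM]] := cvgP _ m_cvg.
  by exists (M + 1) => k; apply: HM => //; rewrite ltrDl.
have M0 : 0 <= M by apply: le_trans (HM 0%N).
have gm_bnd k x : `|g_ k x - mean mu (g_ k)| <=
    (`|C1| * n.+1%:R ^+ q.+1 + M) * (1 + `|x|) ^+ q.+1.
  rewrite (le_trans (ler_normB _ _))// mulrDl lerD//.
  by rewrite (le_trans (HM k))// ler_peMr// exprn_ege1.
have eg_bnd k x : `|enorm (grad (g_ k) x)| <=
    (n%:R * (`|C| * n.+1%:R ^+ q)) * (1 + `|x|) ^+ q.
  rewrite ger0_norm ?enorm_ge0// (le_trans (enorm_le_sum _))//.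
  rewrite -mulrA mulr_natl -[X in _ *+ X](card_ord n) -sumr_const.
  by apply: ler_sum => i _; rewrite mxE.
have [D1 [q1 B1]] := @growth_powR R n p (`|C1| * n.+1%:R ^+ q.+1 + M) q.+1 p0.
have [D2 [q2 B2]] := @growth_powR R n p (n%:R * (`|C| * n.+1%:R ^+ q)) q p0.
have cpow (h : 'rV[R]_n -> R) : continuous h -> continuous (fun x => `|h x| `^ p).
  move=> ch x.
  exact: (@continuous_comp _ _ _ h (fun y => `|y| `^ p) x (ch x)
    (continuous_powR p0 (x := _))).
have lcvg := growth_cvg poincare_smooth (C := D1) (q := q1)
  (h_ := fun k x => `|g_ k x - mean mu (g_ k)| `^ p)
  (h := fun x => `|g x - mean mu g| `^ p).
have rcvg := growth_cvg poincare_smooth (C := D2) (q := q2)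
  (h_ := fun k x => `|enorm (grad (g_ k) x)| `^ p)
  (h := fun x => `|enorm (grad g x)| `^ p).
apply/poincare_forE => //.
apply: (lee_cvg_to (lcvg _ _ _ _) (cvgeZl _ (rcvg _ _ _ _))) => //.
- move=> k; apply/cpow/continuous_subf; first exact: cg_.
  exact: cst_continuous.
- by apply: cpow; apply: continuous_subf; [exact: cg.1|exact: cst_continuous].
- move=> k x; rewrite ger0_norm ?powR_ge0//.
  exact: (B1 (fun x => g_ k x - mean mu (g_ k)) x (gm_bnd k x)).
- move=> x.
  apply: (@cvg_comp _ _ _ _ (fun y : R => `|y| `^ p)); last exact: continuous_powR.
  by apply: cvgB; [exact: g_cvg|exact: m_cvg].
- by move=> k; apply: cpow; exact: continuous_enorm_grad (sg k 1%N).
- by apply: cpow; exact: continuous_enorm_grad.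
- move=> k x; rewrite ger0_norm ?powR_ge0//.
  exact: (B2 (fun x => enorm (grad (g_ k) x)) x (eg_bnd k x)).
- move=> x.
  apply: (@cvg_comp _ _ _ _ (fun y : R => `|y| `^ p)); last exact: continuous_powR.
  apply: (@cvg_comp _ _ _ _ (@Num.sqrt R)); last exact: sqrt_continuous.
  apply: (cvg_big (@add_continuous R)) => i _; rewrite /grad.
  under eq_fun do rewrite mxE.
  by rewrite mxE expr2; under eq_fun do rewrite expr2; apply: cvgM; exact: dg_cvg.
- by apply: nearW => k; apply/poincare_forE => //; exact: poincare_smooth.
Qed.

End extension.

(** * Second-order functions *)

Section matrix_norms.
Context {R : realType} {n : nat}.
Implicit Types (u v w : 'rV[R]_n) (A : 'M[R]_n).

Lemma ler_coord_enorm v (i : 'I_n) : `|v ord0 i| <= enorm v.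
Proof.
rewrite -sqrtr_sqr ler_sqrt ?sumr_ge0// => [|j _]; last exact: sqr_ge0.
by rewrite (bigD1 i)//= lerDl sumr_ge0// => j _; exact: sqr_ge0.
Qed.

Lemma enorm_eq0 v : enorm v = 0 -> v = 0.
Proof.
move=> v0; apply/rowP => i; rewrite mxE; apply/eqP; rewrite -normr_le0 -v0.
exact: ler_coord_enorm.
Qed.

Lemma enorm0 : enorm (0 : 'rV[R]_n) = 0.
Proof. by rewrite /enorm big1 ?sqrtr0// => i _; rewrite mxE expr0n. Qed.

Lemma enormZ (c : R) v : enorm (c *: v) = `|c| * enorm v.
Proof.
rewrite /enorm -sqrtr_sqr -sqrtrM ?sqr_ge0// mulr_sumr.
by congr Num.sqrt; apply: eq_bigr => i _; rewrite mxE exprMn.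
Qed.

(** Termwise weighted arithmetic-geometric inequality; the weight c = |u| / |v| makes the two
    resulting sums equal. *)
Lemma cauchy_schwarz u v : \sum_i u ord0 i * v ord0 i <= enorm u * enorm v.
Proof.
have [u0|u0] := eqVneq (enorm u) 0.
  rewrite u0 mul0r (enorm_eq0 u0) big1// => i _; by rewrite mxE mul0r.
have [v0|v0] := eqVneq (enorm v) 0.
  rewrite v0 mulr0 (enorm_eq0 v0) big1// => i _; by rewrite mxE mulr0.
have up : 0 < enorm u by rewrite lt_neqAle eq_sym u0 enorm_ge0.
have vp : 0 < enorm v by rewrite lt_neqAle eq_sym v0 enorm_ge0.
pose c := enorm u / enorm v.
have H i : u ord0 i * v ord0 i <=
   2^-1 * c^-1 * u ord0 i ^+ 2 + 2^-1 * c * v ord0 i ^+ 2.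
  have c0 : 0 < c by rewrite divr_gt0.
  have cV : c * c^-1 = 1 by rewrite mulfV ?gt_eqF.
  have cV0 : 0 < c^-1 by rewrite invr_gt0.
  have := mulr_ge0 (ltW cV0) (sqr_ge0 (u ord0 i - c * v ord0 i)).
  have -> : c^-1 * (u ord0 i - c * v ord0 i) ^+ 2 = c^-1 * u ord0 i ^+ 2 -
      2 * (c * c^-1) * (u ord0 i * v ord0 i) + (c * c^-1) * c * v ord0 i ^+ 2.
    by ring.
  rewrite cV; lra.
apply: le_trans (ler_sum _ (fun i _ => H i)) _.
rewrite big_split/= -!mulr_sumr -!enorm_sqr /c invf_div.
by rewrite le_eqVlt; apply/orP; left; apply/eqP; field; rewrite u0 v0.
Qed.

Lemma enormD u v : enorm (u + v) <= enorm u + enorm v.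
Proof.
rewrite -(ler_pXn2r (ltn0Sn 1)) ?nnegrE ?addr_ge0 ?enorm_ge0//.
rewrite sqrrD !enorm_sqr.
have -> : \sum_i (u + v) ord0 i ^+ 2 =
    \sum_i u ord0 i ^+ 2 + (\sum_i u ord0 i * v ord0 i) *+ 2 + \sum_i v ord0 i ^+ 2.
  rewrite -sumrMnl -!big_split/=; apply: eq_bigr => i _.
  by rewrite mxE sqrrD.
by rewrite lerD2r lerD2l lerMn2r/= cauchy_schwarz.
Qed.

(** Coordinates of a vector in the unit ball are at most 1 in absolute value, so the sum of the
    absolute values of the entries is a bound. Without it [sup] could be a default value. *)
Lemma opnorm_has_sup A : has_sup [set r | exists x y : 'rV[R]_n,
  [/\ enorm x <= 1, enorm y <= 1 & r = \sum_i \sum_j A i j * x ord0 i * y ord0 j]].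
Proof.
split.
  exists 0, 0, 0; rewrite enorm0; split => //.
  by rewrite big1// => i _; rewrite big1// => j _; rewrite !mxE mulr0.
exists (\sum_i \sum_j `|A i j|) => _ [x [y [x1 y1 ->]]].
apply: ler_sum => i _; apply: ler_sum => j _.
rewrite (le_trans (ler_norm _))// !normrM -mulrA ler_piMr//.
rewrite mulr_ile1//; [apply: le_trans x1|apply: le_trans y1].
  exact: ler_coord_enorm.
exact: ler_coord_enorm.
Qed.

Lemma opnorm_ub A u v : enorm u <= 1 -> enorm v <= 1 ->
  \sum_i \sum_j A i j * u ord0 i * v ord0 j <= opnorm A.
Proof.
move=> u1 v1; apply: sup_upper_bound; first exact: opnorm_has_sup.
by exists u, v.
Qed.

Lemma opnorm_ge0 A : 0 <= opnorm A.
Proof.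
apply: le_trans (@opnorm_ub A 0 0 _ _); rewrite ?enorm0//.
by rewrite big1// => i _; rewrite big1// => j _; rewrite !mxE mulr0.
Qed.

Lemma enorm_mul_le A v : enorm v <= 1 ->
  enorm (\row_i \sum_j A i j * v ord0 j) <= opnorm A.
Proof.
set w := (\row_i _) => v1.
have [->|w0] := eqVneq (enorm w) 0; first exact: opnorm_ge0.
have wp : 0 < enorm w by rewrite lt_neqAle eq_sym w0 enorm_ge0.
(* Testing the bilinear form against the normalized image w / |w| recovers |w|. *)
have u1 : enorm ((enorm w)^-1 *: w) <= 1.
  by rewrite enormZ ger0_norm ?invr_ge0 ?enorm_ge0// mulVf.
apply: le_trans (opnorm_ub A u1 v1).
have -> : \sum_i \sum_j A i j * ((enorm w)^-1 *: w) ord0 i * v ord0 j =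
    (enorm w)^-1 * \sum_i w ord0 i ^+ 2.
  rewrite mulr_sumr; apply: eq_bigr => i _.
  have wE : w ord0 i = \sum_j A i j * v ord0 j by rewrite mxE.
  rewrite expr2 {2}wE mulrA mulr_sumr; apply: eq_bigr => j _.
  by rewrite [_ ord0 i in LHS]mxE; ring.
by rewrite -enorm_sqr expr2 mulKf.
Qed.

Lemma ler_entry_opnorm A (i j : 'I_n) : `|A i j| <= opnorm A.
Proof.
have e1 : enorm (delta_mx ord0 j : 'rV[R]_n) <= 1.
  rewrite /enorm (bigD1 j)//= big1 => [|k kj]; last by rewrite mxE (negbTE kj) expr0n.
  by rewrite mxE !eqxx expr1n addr0 sqrtr1.
apply: le_trans (enorm_mul_le A e1); apply: le_trans (ler_coord_enorm _ i).
rewrite mxE (bigD1 j)//= big1 ?addr0 => [|k kj]; last first.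
  by rewrite mxE (negbTE kj) mulr0.
by rewrite mxE !eqxx mulr1.
Qed.

Lemma hsnorm_sqr A : hsnorm A ^+ 2 = \sum_i \sum_j A i j ^+ 2.
Proof.
rewrite sqr_sqrtr// sumr_ge0// => i _; rewrite sumr_ge0// => j _.
exact: sqr_ge0.
Qed.

End matrix_norms.

Lemma is_derive_comp_rV (R : realType) (n : nat) (F : R -> R) (f : 'rV[R]_n -> R)
    (x v : 'rV[R]_n) (a b : R) :
  is_derive (f x) (1 : R) F a -> is_derive x v f b ->
  is_derive x v (fun y => F (f y)) (a * b).
Proof.
have xE : 0 *: v + x = x by rewrite scale0r add0r.
rewrite -{1 2}xE => dF /is_derive_line df.
have := (is_derive_line (fun y => F (f y)) x v 0 (a * b)).2.
by rewrite xE; apply; exact: is_derive1_comp dF df.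
Qed.

(** * The regularized norm of a family of functions *)

Section smoothed_norm.
Context {R : realType} {n : nat} (e : R).
Hypothesis e0 : 0 < e.
Variable u : 'I_n -> 'rV[R]_n -> R.
Hypothesis cu : forall j, Ck 1 (u j).

Definition snorm (x : 'rV[R]_n) : R := Num.sqrt (e ^+ 2 + \sum_j u j x ^+ 2).

Let Q (x : 'rV[R]_n) : R := e ^+ 2 + \sum_j u j x ^+ 2.

Let Q0 x : 0 < Q x.
Proof. by rewrite ltr_pwDl ?exprn_gt0// sumr_ge0// => j _; exact: sqr_ge0. Qed.

Lemma snorm_gt0 x : 0 < snorm x. Proof. by rewrite sqrtr_gt0 Q0. Qed.

Lemma snorm_sqr x : snorm x ^+ 2 = e ^+ 2 + \sum_j u j x ^+ 2.
Proof. by rewrite sqr_sqrtr //; exact/ltW/Q0. Qed.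

Lemma continuous_snorm : continuous snorm.
Proof.
apply: continuous_sqrtf; apply: continuous_addf; first exact: cst_continuous.
by apply: continuous_sumf => j; apply: continuous_expf; have [] := cu j.
Qed.

Lemma is_derive_snorm i x : is_derive x (delta_mx ord0 i) snorm
  (\sum_j partial i (u j) x * (u j x / snorm x)).
Proof.
have dQ : is_derive x (delta_mx ord0 i) Q (\sum_j 2 * u j x * partial i (u j) x).
  have d1 : is_derive x (delta_mx ord0 i) (\sum_(j < n) u j ^+ 2)
      (\sum_(j < n) (2 * u j x ^+ 1) *: partial i (u j) x).
    apply: (@is_derive_sum _ _ _ _ (fun j => u j ^+ 2) _ _
      (fun j => (2 * u j x ^+ 1) *: partial i (u j) x)) => j.
    exact: (is_deriveX 2 (is_derive_partial x i (cu j))).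
  have := is_deriveD (is_derive_cst (e ^+ 2) x (delta_mx ord0 i)) d1.
  have -> : \sum_(j < n) (2 * u j x ^+ 1) *: partial i (u j) x =
      \sum_j 2 * u j x * partial i (u j) x.
    by apply: eq_bigr => j _; rewrite /GRing.scale/= expr1.
  by rewrite add0r fct_sumE => d; exact: d.
apply: (is_derive_eq (is_derive_comp_rV (is_derive1_sqrt (Q0 x)) dQ)).
rewrite mulr_sumr; apply: eq_bigr => j _.
have s0 : Num.sqrt (Q x) != 0 by rewrite gt_eqF// sqrtr_gt0.
by rewrite /snorm -/(Q x); field.
Qed.

Lemma partial_snorm i : partial i snorm =
  (fun x => \sum_j partial i (u j) x * (u j x / snorm x)).
Proof. by apply: is_derive_partialE => x; exact: is_derive_snorm. Qed.

Lemma snorm_Ck1 : Ck 1 snorm.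
Proof.
apply: (Ck1I continuous_snorm is_derive_snorm) => i.
apply: continuous_sumf => j; apply: continuous_mulf; first exact: continuous_partial.
apply: continuous_mulf; first by have [] := cu j.
move=> x; apply: (@cvgV _ _ (nbhs x)); last exact: continuous_snorm.
by rewrite gt_eqF// snorm_gt0.
Qed.

(** The gradient of [snorm] is the matrix of the partial derivatives of the family applied to this
    vector, so an operator norm bounds it. *)
Lemma enorm_weights_le1 x : enorm (\row_j (u j x / snorm x)) <= 1.
Proof.
rewrite -(@ler_pXn2r _ 2)// ?nnegrE ?enorm_ge0// enorm_sqr expr1n.
under eq_bigr do rewrite mxE exprMn exprVn snorm_sqr.
rewrite -mulr_suml ler_pdivrMr; last exact: Q0.
by rewrite mul1r lerDr sqr_ge0.
Qed.

Lemma le_enorm_snorm x : enorm (\row_j u j x) <= snorm x.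
Proof.
rewrite -(@ler_pXn2r _ 2)// ?nnegrE ?enorm_ge0 ?(ltW (snorm_gt0 x))//.
rewrite enorm_sqr snorm_sqr; under eq_bigr do rewrite mxE.
by rewrite lerDr sqr_ge0.
Qed.

End smoothed_norm.

(** * Expectations of functions of polynomial growth *)

Section means.
Context {R : realType} {n : nat} (mu : probability 'rV[R]_n R) (L : R).
Hypothesis poincare_smooth :
  forall (p : R) (g : 'rV[R]_n -> R), 2 <= p -> smooth g -> poincare_for mu L p g.
Implicit Types g h : 'rV[R]_n -> R.

Let W1 (x : 'rV[R]_n) : 1 <= 1 + `|x|. Proof. by rewrite lerDl. Qed.
Let W0 (x : 'rV[R]_n) : 0 <= 1 + `|x|. Proof. exact: le_trans (W1 x). Qed.

Lemma growth_cst c : growth (fun _ : 'rV[R]_n => c).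
Proof. by exists `|c|, 0%N => x; rewrite mulr1. Qed.

Lemma growthD g h : growth g -> growth h -> growth (fun x => g x + h x).
Proof.
move=> [C [q gC]] [D [r hD]]; exists (`|C| + `|D|), (q + r)%N => x.
rewrite (le_trans (ler_normD _ _))// mulrDl lerD//.
- rewrite (le_trans (gC x))// (@le_trans _ _ (`|C| * (1 + `|x|) ^+ q))//.
    by rewrite ler_wpM2r ?ler_norm// exprn_ge0.
  by rewrite ler_wpM2l// ler_weXn2l// leq_addr.
- rewrite (le_trans (hD x))// (@le_trans _ _ (`|D| * (1 + `|x|) ^+ r))//.
    by rewrite ler_wpM2r ?ler_norm// exprn_ge0.
  by rewrite ler_wpM2l// ler_weXn2l// leq_addl.
Qed.

Lemma growthM g h : growth g -> growth h -> growth (fun x => g x * h x).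
Proof.
move=> [C [q gC]] [D [r hD]]; exists (C * D), (q + r)%N => x.
by rewrite normrM exprD mulrACA ler_pM.
Qed.

Lemma growthX2 g : growth g -> growth (fun x => g x ^+ 2).
Proof. by move=> gg; exact: growthM. Qed.

(** From 2 |g| <= g^2 + 1. It serves for [snorm] and [hsnorm], whose squares are sums of squares of
    known growth. *)
Lemma growth_sqr g : growth (fun x => g x ^+ 2) -> growth g.
Proof.
move=> [C [q gC]]; exists (C + 1), q => x.
have W1q : 1 <= (1 + `|x|) ^+ q by rewrite exprn_ege1.
have := gC x; rewrite normrX mulrDl mul1r => H.
have := sqr_ge0 (`|g x| - 1); nra.
Qed.

Lemma growth_sum (I : Type) (s : seq I) (g : I -> 'rV[R]_n -> R) :
  (forall i, growth (g i)) -> growth (fun x => \sum_(i <- s) g i x).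
Proof.
move=> gg; elim: s => [|i s IHs].
  rewrite (_ : (fun x => _) = (fun=> 0)); first exact: growth_cst.
  by apply/funext => x; rewrite big_nil.
rewrite (_ : (fun x => _) = (fun x => g i x + \sum_(i <- s) g i x)); last first.
  by apply/funext => x; rewrite big_cons.
exact: growthD.
Qed.

Lemma mean_cst c : mean mu (fun=> c) = c.
Proof. by rewrite /mean Rintegral_cst//= probability_setT mulr1. Qed.

Lemma meanD g h : continuous g -> growth g -> continuous h -> growth h ->
  mean mu (fun x => g x + h x) = mean mu g + mean mu h.
Proof.
move=> cg gg ch gh; apply: RintegralD => //.
- exact: (growth_integrable poincare_smooth cg gg).
- exact: (growth_integrable poincare_smooth ch gh).
Qed.

Lemma meanZ c g : continuous g -> growth g ->
  mean mu (fun x => c * g x) = c * mean mu g.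
Proof.
move=> cg gg; apply: RintegralZl => //.
exact: (growth_integrable poincare_smooth cg gg).
Qed.

Lemma mean_sum (I : Type) (s : seq I) (g : I -> 'rV[R]_n -> R) :
  (forall i, continuous (g i)) -> (forall i, growth (g i)) ->
  mean mu (fun x => \sum_(i <- s) g i x) = \sum_(i <- s) mean mu (g i).
Proof.
move=> cg gg; elim: s => [|i s IHs].
  by rewrite big_nil -[RHS]mean_cst; congr mean; apply/funext => x; rewrite big_nil.
rewrite big_cons -IHs -meanD//; last first.
- exact: growth_sum.
- exact: continuous_sumf.
by congr mean; apply/funext => x; rewrite big_cons.
Qed.

Lemma mean_ge0 g : (forall x, 0 <= g x) -> 0 <= mean mu g.
Proof. by move=> g0; apply: Rintegral_ge0. Qed.

(** The variance, expanded, is nonnegative. *)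
Lemma sqr_mean_le g : continuous g -> growth g ->
  mean mu g ^+ 2 <= mean mu (fun x => g x ^+ 2).
Proof.
move=> cg gg; set m := mean mu g.
have : 0 <= mean mu (fun x => (g x - m) ^+ 2) by apply: mean_ge0 => x; exact: sqr_ge0.
have -> : (fun x => (g x - m) ^+ 2) =
    (fun x => g x ^+ 2 + ((- 2 * m) * g x + m ^+ 2)).
  by apply/funext => x; ring.
have c2 : continuous (fun x => g x ^+ 2) by exact: continuous_expf.
have g2 : growth (fun x => g x ^+ 2) by exact: growthX2.
have cl : continuous (fun x => (- 2 * m) * g x).
  by apply: continuous_mulf => //; exact: cst_continuous.
have gl : growth (fun x => (- 2 * m) * g x).
  by apply: growthM => //; exact: growth_cst.
rewrite meanD//; last 2 first.
- by apply: continuous_addf => //; exact: cst_continuous.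
- by apply: growthD => //; exact: growth_cst.
rewrite meanD//; [|exact: cst_continuous|exact: growth_cst].
by rewrite meanZ// mean_cst -/m; lra.
Qed.

Lemma integral_powR2 g : continuous g -> growth g ->
  (\int[mu]_x (`|g x| `^ 2)%:E = (mean mu (fun x => g x ^+ 2))%:E)%E.
Proof.
move=> cg gg.
have c2 : continuous (fun x => g x ^+ 2) by exact: continuous_expf.
have i2 := growth_integrable poincare_smooth c2 (growthX2 gg).
rewrite /mean /Rintegral fineK; last exact: integrable_fin_num i2.
by apply: eq_integral => x _; rewrite powR_mulrn// real_normK ?num_real.
Qed.

Lemma Lnorm2E g : continuous g -> growth g ->
  'N[mu]_(2%:E)[EFin \o g]%E = (Num.sqrt (mean mu (fun x => g x ^+ 2)))%:E.
Proof.
move=> cg gg; rewrite LnormE integral_powR2// poweR_EFin powR12_sqrt//.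
by apply: mean_ge0 => x; exact: sqr_ge0.
Qed.

End means.

(** * The moment bound for functions with bounded Hessian *)

Section second_order.
Context {R : realType} {n : nat} (mu : probability 'rV[R]_n R) (L : R).
Hypothesis L0 : 0 < L.
Hypothesis poincare_smooth :
  forall (p : R) (g : 'rV[R]_n -> R), 2 <= p -> smooth g -> poincare_for mu L p g.
Variable f : 'rV[R]_n -> R.
Hypothesis cf : Ck 2 f.
Variable M : R.
Hypothesis HM : forall x, opnorm (hessian f x) <= M.

Let v := vmean mu (grad f).
Let K : R := fine 'N[mu]_(+oo)[EFin \o (fun x => opnorm (hessian f x))]%E.
Let S2 : R := mean mu (fun x => hsnorm (hessian f x) ^+ 2).

Lemma Ck2_partial i : Ck 1 (partial i f).
Proof. by have [_ /(_ i)[]] := cf. Qed.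

Lemma Ck2_Ck1 : Ck 1 f.
Proof.
have [cf0 df] := cf; split=> // i; split; first by have [] := df i.
by have [] := Ck2_partial i.
Qed.

Lemma hessian_entry i j x : partial i (partial j f) x = hessian f x i j.
Proof. by rewrite mxE. Qed.

Lemma partial2_le i j x : `|partial i (partial j f) x| <= M.
Proof. by rewrite hessian_entry (le_trans (ler_entry_opnorm _ _ _)). Qed.

Lemma partial2_growth i j x : `|partial i (partial j f) x| <= M * (1 + `|x|) ^+ 0.
Proof. by rewrite expr0 mulr1 partial2_le. Qed.

Lemma vmean_coord j : v ord0 j = mean mu (partial j f).
Proof. by rewrite mxE; congr mean; apply/funext => x; rewrite mxE. Qed.

Lemma growth_partial j : growth (partial j f).
Proof.
have [C HC] := growth_Ck1 (Ck2_partial j) (fun i => partial2_growth i j).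
by exists C, 1%N.
Qed.

Lemma poincare_Ck2 p : 2 <= p -> poincare_for mu L p f.
Proof.
move=> p2.
have /choice[C HC] : forall j, exists C, forall x,
    `|partial j f x| <= C * (1 + `|x|) ^+ 1.
  move=> j.
  exact: (growth_Ck1 (Ck2_partial j) (fun i => partial2_growth i j)).
apply: (poincare_C1 L0 poincare_smooth (C := \sum_j `|C j|) (q := 1) p2
  Ck2_Ck1) => j x.
rewrite (le_trans (HC j x))// ler_wpM2r ?exprn_ge0 ?addr_ge0//.
by rewrite (le_trans (ler_norm _))// (bigD1 j)//= lerDl sumr_ge0.
Qed.

Let u j : 'rV[R]_n -> R := fun x => partial j f x - v ord0 j.

Lemma centered_Ck1 j : Ck 1 (u j).
Proof.
apply: (@Ck1I _ _ _ (fun i => partial i (partial j f))).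
- by apply: continuous_subf; [have [] := Ck2_partial j|exact: cst_continuous].
- move=> i x; rewrite -[X in is_derive _ _ _ X]subr0; apply: is_deriveB.
  by apply: is_derive_partial; exact: Ck2_partial.
- by move=> i; apply: continuous_partial; exact: Ck2_partial.
Qed.

Lemma partial_centered i j : partial i (u j) = partial i (partial j f).
Proof.
apply: is_derive_partialE => x; rewrite -[X in is_derive _ _ _ X]subr0.
by apply: is_deriveB; apply: is_derive_partial; exact: Ck2_partial.
Qed.

(** The everywhere bound M makes the essential supremum finite, so [fine] loses nothing; the sharper
    constant K then holds almost everywhere. *)
Lemma opnormN_bounds : [/\ 0 <= K,
  'N[mu]_(+oo)[EFin \o (fun x => opnorm (hessian f x))]%E = K%:E &
  {ae mu, forall x, opnorm (hessian f x) <= K}].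
Proof.
have N0 : (0 <= 'N[mu]_(+oo)[EFin \o (fun x => opnorm (hessian f x))])%E.
  exact: Lnorm_ge0.
(* The definition of the norm of index [+oo] branches on the positivity of the total mass. *)
have mu0 : (0 < mu [set: 'rV[R]_n])%E by rewrite probability_setT.
have NM : ('N[mu]_(+oo)[EFin \o (fun x => opnorm (hessian f x))] <= M%:E)%E.
  rewrite unlock mu0; apply/ess_supP; apply: nearW => x /=.
  by rewrite lee_fin ger0_norm ?opnorm_ge0.
have NK : 'N[mu]_(+oo)[EFin \o (fun x => opnorm (hessian f x))]%E = K%:E.
  by rewrite /K fineK// ge0_fin_numE// (le_lt_trans NM)// ltry.
split=> //; first by rewrite -lee_fin -NK.
have := ess_sup_ge mu (abse \o (EFin \o (fun x => opnorm (hessian f x)))).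
move: NK; rewrite unlock mu0 => ->; apply: filterS => x /=.
by rewrite lee_fin ger0_norm ?opnorm_ge0.
Qed.

Lemma grad_snorm_le e x : 0 < e -> enorm (grad (snorm e u) x) <= opnorm (hessian f x).
Proof.
move=> e0; have := enorm_mul_le (hessian f x) (enorm_weights_le1 e0 u x).
congr (_ <= _); congr enorm; apply/rowP => i; rewrite !mxE partial_snorm//; last first.
  exact: centered_Ck1.
by apply: eq_bigr => j _; rewrite partial_centered !mxE.
Qed.

(** The integrand is at most K almost everywhere, and in a probability space the constant K has
    p-norm K for every p. *)
Lemma Lnorm_grad_snorm_le p e : 0 < p -> 0 < e ->
  ('N[mu]_p%:E[EFin \o (fun x => enorm (grad (snorm e u) x))] <= K%:E)%E.
Proof.
move=> p0 e0; have [K0 _ HK] := opnormN_bounds.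
have <- : 'N[mu]_p%:E[EFin \o cst K]%E = K%:E by rewrite Lnorm_cst// ger0_norm.
have cS : continuous (fun x => enorm (grad (snorm e u) x)).
  by apply/continuous_enorm_grad/snorm_Ck1 => // j; exact: centered_Ck1.
rewrite !LnormE; apply: gt0_ler_poweR; rewrite ?invr_ge0 ?(ltW p0)//.
1,2: by rewrite in_itv/= leey andbT; apply: integral_ge0 => x _;
  rewrite lee_fin powR_ge0.
have ge (h : 'rV[R]_n -> R) (x : 'rV[R]_n) :
    [set: 'rV[R]_n] x -> (0 <= (`|h x| `^ p)%:E)%E.
  by move=> _; rewrite lee_fin powR_ge0.
have ck : continuous (cst K : 'rV[R]_n -> R) by exact: cst_continuous.
apply: (ae_ge0_le_integral measurableT (ge _)
  (measurable_norm_powR p (continuous_measurable_rV cS)) (ge _)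
  (measurable_norm_powR p (continuous_measurable_rV ck))).
apply: filterS HK => x HK _; rewrite lee_fin ge0_ler_powR ?nnegrE ?(ltW p0)//.
by rewrite !ger0_norm ?enorm_ge0// (le_trans (grad_snorm_le x e0)).
Qed.

Lemma continuous_hsnorm : continuous (fun x => hsnorm (hessian f x)).
Proof.
apply: continuous_sqrtf; apply: continuous_sumf => i; apply: continuous_sumf => j.
apply: continuous_expf; rewrite (_ : (fun x => _) = partial i (partial j f)).
  by apply: continuous_partial; exact: Ck2_partial.
by apply/funext => x; rewrite mxE.
Qed.

Lemma growth_partial2 i j : growth (partial i (partial j f)).
Proof. by exists M, 0%N; exact: partial2_growth. Qed.

Lemma growth_hsnorm : growth (fun x => hsnorm (hessian f x)).
Proof.
apply: growth_sqr; rewrite (_ : (fun x => _) =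
    (fun x => \sum_i \sum_j partial i (partial j f) x ^+ 2)).
  by do 2 apply: growth_sum => ?; apply: growthX2; exact: growth_partial2.
apply/funext => x; rewrite hsnorm_sqr.
by apply: eq_bigr => i _; apply: eq_bigr => j _; rewrite mxE.
Qed.

Lemma Lnorm_hsnorm :
  'N[mu]_(2%:E)[EFin \o (fun x => hsnorm (hessian f x))]%E = (Num.sqrt S2)%:E.
Proof. exact: (Lnorm2E poincare_smooth continuous_hsnorm growth_hsnorm). Qed.

Lemma growth_centered j : growth (u j).
Proof. by apply: growthD; [exact: growth_partial|exact: growth_cst]. Qed.

Lemma growth_enorm_grad_partial j : growth (fun x => enorm (grad (partial j f) x)).
Proof.
have [C [q hC]] : growth (fun x => \sum_i `|partial i (partial j f) x|).
  apply: growth_sum => i; have [C [q hC]] := growth_partial2 i j.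
  by exists C, q => x; rewrite normr_id.
exists C, q => x; rewrite ger0_norm ?enorm_ge0//; apply: le_trans (hC x).
rewrite ger0_norm ?sumr_ge0//; apply: le_trans (enorm_le_sum _) _.
by apply: ler_sum => i _; rewrite mxE.
Qed.

(** The extended inequality at p = 2 for the j-th partial derivative, squared: the constant is (L
    sqrt 2)^2. *)
Lemma centered_variance j : mean mu (fun x => u j x ^+ 2) <=
  2 * L ^+ 2 * mean mu (fun x => enorm (grad (partial j f) x) ^+ 2).
Proof.
have := poincare_C1 L0 poincare_smooth (lexx 2) (Ck2_partial j)
  (fun i => partial2_growth i j).
move=> /(poincare_forE mu L0)-/(_ (ltr0Sn _ 1)).
have -> : (fun x => (`|partial j f x - mean mu (partial j f)| `^ 2)%:E) =
    (fun x => (`|u j x| `^ 2)%:E).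
  by apply/funext => x; rewrite /u vmean_coord.
have cu : continuous (u j) by have [] := centered_Ck1 j.
rewrite (integral_powR2 poincare_smooth cu (growth_centered j)).
rewrite (integral_powR2 poincare_smooth (continuous_enorm_grad (Ck2_partial j))
  (growth_enorm_grad_partial j)).
rewrite -EFinM lee_fin powR_mulrn ?mulr_ge0 ?sqrtr_ge0 ?(ltW L0)//.
by rewrite exprMn sqr_sqrtr// [L ^+ 2 * 2]mulrC.
Qed.

Lemma mean_snorm_le e : 0 < e ->
  mean mu (snorm e u) <= e + Num.sqrt 2 * L * Num.sqrt S2.
Proof.
move=> e0.
have cu j : Ck 1 (u j) := centered_Ck1 j.
have cS : continuous (snorm e u) by exact: continuous_snorm.
have cu2 j : continuous (fun x => u j x ^+ 2).
  by apply: continuous_expf; have [] := cu j.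
have gu2 j : growth (fun x => u j x ^+ 2) by apply: growthX2; exact: growth_centered.
have sE : (fun x => snorm e u x ^+ 2) = (fun x => e ^+ 2 + \sum_j u j x ^+ 2).
  by apply/funext => x; rewrite snorm_sqr.
have gsum : growth (fun x => \sum_j u j x ^+ 2) by exact: growth_sum.
have csum : continuous (fun x => \sum_j u j x ^+ 2) by exact: continuous_sumf.
have gS : growth (snorm e u).
  by apply: growth_sqr; rewrite sE; apply: growthD => //; exact: growth_cst.
have S20 : 0 <= S2 by apply: mean_ge0 => x; exact: sqr_ge0.
have := sqr_mean_le poincare_smooth cS gS.
rewrite sE (meanD poincare_smooth)//; [|exact: cst_continuous|exact: growth_cst].
rewrite mean_cst (mean_sum poincare_smooth)//.
have : \sum_j mean mu (fun x => u j x ^+ 2) <= 2 * L ^+ 2 * S2.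
  apply: le_trans (ler_sum _ (fun j _ => centered_variance j)) _.
  have L20 : 0 <= 2 * L ^+ 2 by rewrite mulr_ge0 ?sqr_ge0.
  rewrite -mulr_sumr ler_wpM2l// le_eqVlt; apply/orP; left; apply/eqP.
  (* The squared gradients of the partial derivatives are the column sums of the squared Hessian
     entries, and add up to the squared Hilbert-Schmidt norm. *)
  transitivity (mean mu (fun x => \sum_j enorm (grad (partial j f) x) ^+ 2)).
    apply/esym; apply: (@mean_sum R n mu L poincare_smooth _ _
      (fun j x => enorm (grad (partial j f) x) ^+ 2)) => j.
      by apply: continuous_expf; apply: continuous_enorm_grad; exact: Ck2_partial.
    by apply: growthX2; exact: growth_enorm_grad_partial.
  congr mean; apply/funext => x.
  rewrite hsnorm_sqr exchange_big/=; apply: eq_bigr => j _.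
  by rewrite enorm_sqr; apply: eq_bigr => i _; rewrite !mxE.
have r0 : 0 <= Num.sqrt 2 * L * Num.sqrt S2 by rewrite !mulr_ge0 ?sqrtr_ge0// ltW.
have rE : (Num.sqrt 2 * L * Num.sqrt S2) ^+ 2 = 2 * L ^+ 2 * S2.
  by rewrite !exprMn !sqr_sqrtr.
rewrite -rE => h1 h2.
rewrite -(ler_pXn2r (ltn0Sn 1)) ?nnegrE ?addr_ge0 ?(ltW e0)//; last first.
  by apply: mean_ge0 => x; exact: sqrtr_ge0.
(* With r the Hessian term, the squared mean is at most e^2 + r^2 <= (e + r)^2. *)
apply: (le_trans h2); rewrite sqrrD -addrA lerD2l.
by apply: (le_trans h1); rewrite lerDr mulrn_wge0// mulr_ge0// ltW.
Qed.

Lemma moment_bound p : 2 <= p ->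
  ('N[mu]_p%:E[EFin \o (fun x => f x - mean mu f)%R] <=
   (L * Num.sqrt p * (enorm v + Num.sqrt 2 * L * Num.sqrt S2) + L ^+ 2 * p * K)%:E)%E.
Proof.
move=> p2; have p1 : 1 <= p by rewrite (le_trans _ p2)// ler1n.
have p0 : 0 < p by exact: lt_le_trans p2.
have [K0 _ _] := opnormN_bounds.
have Lp0 : 0 <= L * Num.sqrt p by rewrite mulr_ge0 ?sqrtr_ge0// ltW.
(* It remains to bound the gradient norm with an error e, which is then sent to 0; the inequality
   for f supplies the second factor sqrt p, and sqrt p squared is p. *)
suff H e : 0 < e -> ('N[mu]_p%:E[EFin \o (fun x => enorm (grad f x))] <=
    (enorm v + (e + Num.sqrt 2 * L * Num.sqrt S2) + L * Num.sqrt p * K)%:E)%E.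
  apply: le_trans (poincare_Ck2 p2) _.
  have H' : ('N[mu]_p%:E[EFin \o (fun x => enorm (grad f x))] <=
      (enorm v + Num.sqrt 2 * L * Num.sqrt S2 + L * Num.sqrt p * K)%:E)%E.
    apply/lee_addgt0Pr => e e0; apply: le_trans (H e e0) _.
    by rewrite -EFinD lee_fin le_eqVlt; apply/orP; left; apply/eqP; ring.
  apply: le_trans (lee_wpmul2l _ H') _; first by rewrite lee_fin.
  rewrite -EFinM lee_fin [leLHS]mulrDr lerD2l -[in leRHS](sqr_sqrtr (ltW p0)).
  by rewrite le_eqVlt; apply/orP; left; apply/eqP; ring.
move=> e0; have cu j : Ck 1 (u j) := centered_Ck1 j.
have cS : continuous (snorm e u) by exact: continuous_snorm.
have S0 x : 0 <= snorm e u x by exact: sqrtr_ge0.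
have m0 : 0 <= mean mu (snorm e u) by apply: mean_ge0.
have cf1 := continuous_enorm_grad Ck2_Ck1.
have cD : continuous (fun x => snorm e u x - mean mu (snorm e u)).
  by apply: continuous_subf => //; exact: cst_continuous.
have ccst (c : R) : continuous (cst c : 'rV[R]_n -> R) by exact: cst_continuous.
(* Since |grad f| <= |v| + g_e pointwise, it is dominated by the constant c plus the centred g_e:
   Minkowski separates them, and the inequality applies to the second. *)
pose c := enorm v + mean mu (snorm e u).
have step1 : ('N[mu]_p%:E[EFin \o (fun x => enorm (grad f x))] <=
    'N[mu]_p%:E[EFin \o (cst c \+ (fun x => snorm e u x - mean mu (snorm e u)))%R])%E.
  apply: ge0_Lnorm_le => //.
    by apply: continuous_addf => //; exact: ccst.
  move=> x /=.
  have -> : c + (snorm e u x - mean mu (snorm e u)) = enorm v + snorm e u x.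
    by rewrite /c; ring.
  rewrite !ger0_norm ?addr_ge0 ?enorm_ge0//.
  have -> : grad f x = v + \row_j u j x.
    by apply/rowP => j; rewrite [LHS]mxE [RHS]mxE [X in _ + X]mxE /u addrC subrK.
  by rewrite (le_trans (enormD _ _))// lerD2l le_enorm_snorm.
apply: le_trans step1 _.
apply: le_trans (minkowski_EFin _ (continuous_measurable_rV (ccst c))
  (continuous_measurable_rV cD) p1) _.
rewrite Lnorm_cst// ger0_norm ?addr_ge0 ?enorm_ge0// [leRHS]EFinD.
apply: leeD.
  by rewrite lee_fin lerD2l mean_snorm_le.
(* The regularized norm has bounded gradient, so it is admissible with growth exponent 0. *)
have dS i x : `|partial i (snorm e u) x| <= M * (1 + `|x|) ^+ 0.
  rewrite expr0 mulr1 (le_trans _ (HM x))// (le_trans _ (grad_snorm_le x e0))//.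
  by apply: le_trans (ler_coord_enorm _ i); rewrite mxE.
apply: le_trans (poincare_C1 L0 poincare_smooth p2 (snorm_Ck1 e0 cu) dS) _.
rewrite [leRHS]EFinM; apply: lee_wpmul2l; first by rewrite lee_fin.
exact: Lnorm_grad_snorm_le.
Qed.

End second_order.

(** * From moments to tails *)

Lemma Lnorm_tail (R : realType) (n : nat) (mu : probability 'rV[R]_n R)
    (g : 'rV[R]_n -> R) (p t : R) : continuous g -> 0 < p -> 0 < t ->
  ('N[mu]_p%:E[EFin \o g] <= (t / expR 1)%:E)%E ->
  (mu [set x | (t <= `|g x|)%R] <= (expR (- p))%:E)%E.
Proof.
move=> cg p0 t0 gt.
have tp : 0 < t `^ p by rewrite powR_gt0.
have := @le_integral_comp_abse _ _ R mu setT measurableT (EFin \o g) t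
  (fun y => (y `^ p)%E) (measurable_poweR p).
move=> /(_ _ _ (continuous_measurable_EFin cg) t0) H.
have {}H : ((t `^ p)%:E * mu [set x | (t <= `|g x|)%R] <= ((t / expR 1) `^ p)%:E)%E.
  rewrite -[X in mu X]setTI -poweR_EFin; apply: le_trans (H _ _) _.
  - by move=> r _; exact: poweR_ge0.
  - move=> x y; rewrite !inE/= !in_itv/= !andbT => x0 y0.
    by apply: gt0_ler_poweR; rewrite ?(ltW p0)// in_itv/= leey andbT.
  rewrite -poweR_Lnorm ?gt_eqF// -poweR_EFin.
  apply: gt0_ler_poweR gt; rewrite ?(ltW p0)// in_itv/= leey andbT ?Lnorm_ge0//.
  by rewrite lee_fin divr_ge0 ?expR_ge0// ltW.
rewrite -(@lee_pmul2l _ (t `^ p)%:E)// ?lte_fin//; apply: le_trans H _.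
rewrite -EFinM lee_fin powRM ?(ltW t0) ?invr_ge0 ?expR_ge0//.
rewrite ler_wpM2l ?(ltW tp)// -expRN.
by rewrite /powR gt_eqF ?expR_gt0// expRK mulrN1.
Qed.

(** With q the minimum: p = q is admissible if q >= 2; if q < 2 the right-hand side is at least 1;
    if q is infinite, that is a = b = 0, every p >= 2 is admissible and P must vanish. *)
Lemma tail_of_moments (R : realType) (a b t : R) (P : \bar R) :
  0 <= a -> 0 <= b -> 0 < t -> (P <= 1)%E ->
  (forall p, 2 <= p -> Num.sqrt p * a <= t -> p * b <= t ->
    (P <= (expR (- p))%:E)%E) ->
  (P <= (expR 1 ^+ 2)%:E *
    expeR (- Order.min ((t ^+ 2)%:E / (a ^+ 2)%:E) (t%:E / b%:E)))%E.
Proof.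
move=> a0 b0 t0 P1 HP.
set q := Order.min _ _.
have qa : (q <= (t ^+ 2)%:E / (a ^+ 2)%:E)%E by rewrite ge_min lexx.
have qb : (q <= t%:E / b%:E)%E by rewrite ge_min lexx orbT.
have q0 : (0 <= q)%E.
  by rewrite le_min !mule_ge0 ?inve_ge0 ?lee_fin ?sqr_ge0// ltW.
have {}HP p : 2 <= p -> (p%:E <= q)%E -> (P <= (expR (- p))%:E)%E.
  move=> p2 pq; have p0 : 0 < p by exact: lt_le_trans p2.
  apply: HP => //.
  (* For a = 0 the ratio is [+oo] and carries no information, but the condition to prove reads 0 <=
     t. *)
  - have [->|an0] := eqVneq a 0; first by rewrite mulr0 ltW.
    have := le_trans pq qa; rewrite inver sqrf_eq0 (negbTE an0) -EFinM lee_fin.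
    have a2 : 0 < a ^+ 2 by rewrite exprn_gt0// lt_neqAle eq_sym an0.
    rewrite ler_pdivlMr// => H.
    rewrite -(ler_pXn2r (ltn0Sn 1)) ?nnegrE ?mulr_ge0 ?sqrtr_ge0 ?(ltW t0)//.
    by rewrite exprMn sqr_sqrtr// ltW.
  - have [->|bn0] := eqVneq b 0; first by rewrite mulr0 ltW.
    have := le_trans pq qb; rewrite inver (negbTE bn0) -EFinM lee_fin.
    by rewrite ler_pdivlMr// lt_neqAle eq_sym bn0.
have e2 : expR 1 ^+ 2 = expR 2 :> R by rewrite -expRM_natl mulr1.
clearbody q; case: q q0 HP {qa qb} => [r| |] //= r0 HP.
- rewrite -EFinM e2 -expRD; have [r2|/ltW r2] := leP 2 r.
    apply: (le_trans (HP r r2 (lexx _))).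
    by rewrite lee_fin ler_expR lerDr.
  apply: (le_trans P1); rewrite lee_fin -[leLHS]expR0 ler_expR.
  by rewrite subr_ge0.
- rewrite mule0; apply/lee_addgt0Pr => e e0; rewrite add0e.
  (* With p = 2 + 1 / e, exp p >= 1 + p > 1 / e, so exp (- p) falls below the arbitrary e. *)
  have p2 : 2 <= 2 + e^-1 by rewrite lerDl invr_ge0 ltW.
  apply: (le_trans (HP _ p2 (leey _))).
  rewrite lee_fin expRN -[leRHS]invrK lef_pV2 ?posrE ?expR_gt0 ?invr_gt0//.
  apply: le_trans (expR_ge1Dx _); lra.
Qed.

Theorem theorem3p14 (R : realType) (n : nat) (L : R)
    (mu : probability 'rV[R]_n R) :
  0 < L ->
  mu `<< @lebesgue_rV R n ->
  (forall (p : R) (g : 'rV[R]_n -> R), 2 <= p -> smooth g ->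
    ('N[mu]_(p%:E)[EFin \o (fun x => g x - mean mu g)%R] <=
     (L * Num.sqrt p)%:E * 'N[mu]_(p%:E)[EFin \o (fun x => enorm (grad g x))])%E) ->
  forall f : 'rV[R]_n -> R,
  Ck 2 f ->
  (exists M : R, forall x, opnorm (hessian f x) <= M) ->
  let a2 : \bar R := ((4 * expR 1 ^+ 2)%:E *
    ((Num.sqrt 2 * L ^+ 2)%:E * 'N[mu]_(2%:E)[EFin \o (fun x => hsnorm (hessian f x))]
     + (L * enorm (vmean mu (grad f)))%:E) ^+ 2)%E in
  let b : \bar R := ((2 * expR 1 * L ^+ 2)%:E *
    'N[mu]_(+oo)[EFin \o (fun x => opnorm (hessian f x))])%E in
  forall t : R, 0 < t ->
  (mu [set x | (t <= `|f x - mean mu f|)%R] <=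
   (expR 1 ^+ 2)%:E * expeR (- Order.min ((t ^+ 2)%:E / a2) (t%:E / b)))%E.
Proof.
move=> L0 _ poincare_smooth f cf [M HM] a2 b t t0.
pose K : R := fine 'N[mu]_(+oo)[EFin \o (fun x => opnorm (hessian f x))]%E.
pose S2 : R := mean mu (fun x => hsnorm (hessian f x) ^+ 2).
pose v := vmean mu (grad f).
have [K0 NK _] := opnormN_bounds mu HM.
pose a' := 2 * expR 1 * (Num.sqrt 2 * L ^+ 2 * Num.sqrt S2 + L * enorm v).
pose b' := 2 * expR 1 * L ^+ 2 * K.
have -> : a2 = (a' ^+ 2)%:E.
  rewrite /a2 (Lnorm_hsnorm poincare_smooth cf HM) -EFinM.
  by congr EFin; rewrite /a' -/S2 -/v; ring.
have -> : b = b'%:E by rewrite /b NK -EFinM.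
have e0 : 0 < expR 1 :> R by exact: expR_gt0.
apply: tail_of_moments => //.
- by rewrite !mulr_ge0 ?addr_ge0 ?mulr_ge0 ?sqrtr_ge0 ?sqr_ge0 ?(ltW L0) ?(ltW e0).
- by rewrite !mulr_ge0 ?(ltW L0) ?(ltW e0).
- apply: probability_le1.
  have cD : continuous (fun x => `|f x - mean mu f|).
    by apply/continuous_normf/continuous_subf; [exact: cf.1|exact: cst_continuous].
  have := continuous_measurable_rV cD measurableT (measurable_itv `[t, +oo[).
  rewrite setTI; congr measurable; apply/seteqP.
  by split=> x; rewrite /= in_itv/= andbT.
move=> p p2 pa pb; have p0 : 0 < p by exact: lt_le_trans p2.
apply: Lnorm_tail => //.
  by apply: continuous_subf; [exact: cf.1|exact: cst_continuous].
apply: le_trans (moment_bound L0 poincare_smooth cf HM p2) _.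
rewrite lee_fin ler_pdivlMr//.
rewrite -/v -/S2 -/K.
(* The factors 2 in [a'] and [b'] turn the bound into the average of [sqrt p * a'] and [p * b'],
   each at most t by the choice of p. *)
have -> : (L * Num.sqrt p * (enorm v + Num.sqrt 2 * L * Num.sqrt S2) +
    L ^+ 2 * p * K) * expR 1 = 2^-1 * (Num.sqrt p * a' + p * b').
  by rewrite /a' /b'; field.
lra.
Qed.
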